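(* Let $(M_n)_{n\ge1}$ and $(N_n)_{n\ge1}$ be sequences of positive integers with $M_n\ge 2$ and $N_n\le M_n^2$ for all $n$, and suppose that $$s=\liminf_{n\to\infty}\frac{\sum_{i=1}^n\log N_i}{\sum_{i=1}^n\log M_i}<1 .$$ Let $F=F(\omega)\subset[0,1]^2$ be the random Cantor set with defining sequences $(M_n)$ and $(N_n)$. Then, almost surely, for all lines $\ell$ in the plane simultaneously, $\dim_H \pi_\ell(F)=s$.
   Context: For $k\in\mathbb N$ and a square $Q=[x,x+\lambda]\times[y,y+\lambda]\subset[0,1]^2$, the $k$-adic grid of $Q$ is the family of the $k^2$ closed subsquares of $Q$ of side-length $\lambda/k$ obtained by dividing $Q$ evenly. Random Cantor set with defining sequences $(M_n),(N_n)$: First choose $\mathcal F_1=(Q_{1,1},\dots,Q_{1,N_1})$, where the $Q_{1,i}$ are chosen independently and uniformly (each square with probability $M_1^{-2}$) from the $M_1$-adic grid of $[0,1]^2$; repetitions are allowed. Given $\mathcal F_n=(Q_{n,1},\dots,Q_{n,P_n})$, $P_n=\prod_{k=1}^nN_k$, for each index $j\in\{1,\dots,P_n\}$ choose, independently for different $j$ and independently of the past, $N_{n+1}$ squares independently and uniformly (each with probability $M_{n+1}^{-2}$, repetitions allowed) from the $M_{n+1}$-adic grid of $Q_{n,j}$; $\mathcal F_{n+1}$ is the tuple, counted with multiplicity, of all the squares chosen in this way. The elements of $\mathcal F_n$ need not be disjoint or distinct. The limit set is $$F=\bigcap_{n=1}^\infty\bigcup_{Q\in\mathcal F_n}Q .$$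 $\pi_\ell$ denotes the orthogonal projection onto the line $\ell$, and $\dim_H$ is Hausdorff dimension. *)

(* Defs.v *)
From HB Require Import structures.
From mathcomp Require Import all_boot all_order all_algebra.
From mathcomp Require Import all_classical all_reals all_analysis.
From mathcomp Require Import ring.

Set Implicit Arguments.
Unset Strict Implicit.
Unset Printing Implicit Defensive.

Import Order.TTheory GRing.Theory Num.Theory.
Import numFieldNormedType.Exports.

Local Open Scope classical_set_scope.
Local Open Scope ring_scope.

Section hausdorff.
Context {R : realType}.
Implicit Types (A U : set (R * R)) (x y : R * R) (t delta : R).

(* The library norm on R * R is the sup norm, hence this definition. *)
Definition euclid_dist x y : R :=
  Num.sqrt ((x.1 - y.1) ^+ 2 + (x.2 - y.2) ^+ 2).

Definition diameter U : \bar R :=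
  if U == set0 then 0%E
  else ereal_sup [set (euclid_dist xy.1 xy.2)%:E | xy in U `*` U].

(* The empty set contributes 0 also for t = 0, where powers are equal to 1. *)
Definition hausdorff_gauge t U : \bar R :=
  if U == set0 then 0%E else (diameter U `^ t)%E.

Definition hausdorff_premeasure t delta A : \bar R :=
  ereal_inf [set (\sum_(0 <= i <oo) hausdorff_gauge t (U i))%E | U in
    [set U : nat -> set (R * R) |
      A `<=` \bigcup_i U i /\ forall i, (diameter (U i) <= delta%:E)%E]].

(* The supremum over delta is the limit as delta tends to 0. *)
Definition hausdorff_measure t A : \bar R :=
  ereal_sup [set hausdorff_premeasure t delta A | delta in [set delta | 0 < delta]].

Definition hausdorff_dim A : \bar R :=
  ereal_inf [set t%:E | t in [set t | 0 <= t /\ hausdorff_measure t A = 0%E]].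

End hausdorff.

Section projection.
Context {R : realType}.
Implicit Types p u x : R * R.

Definition dotp x u : R := x.1 * u.1 + x.2 * u.2.

(* The line through p with direction u (a line when u != 0). *)
Definition line p u : set (R * R) :=
  [set (p.1 + t * u.1, p.2 + t * u.2) | t in [set: R]].

(* The orthogonal projection onto line p u, for u != 0. *)
Definition line_proj p u x : R * R :=
  let t := dotp (x.1 - p.1, x.2 - p.2) u / dotp u u in
  (p.1 + t * u.1, p.2 + t * u.2).

Lemma line_projP p u x : u != 0 ->
  line p u (line_proj p u x) /\
  dotp (x.1 - (line_proj p u x).1, x.2 - (line_proj p u x).2) u = 0.
Proof.
move=> u0; split; first by eexists.
have uu0 : dotp u u != 0.
  apply: contra u0; rewrite /dotp -!expr2 paddr_eq0 ?sqr_ge0// !sqrf_eq0.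
  by case: u => a b /= /andP[/eqP -> /eqP ->].
by rewrite /line_proj /dotp /= in uu0 *; field.
Qed.

End projection.

Section squares.
Context {R : realType}.

(* The closed square [sq_x, sq_x + sq_side] x [sq_y, sq_y + sq_side]. *)
Record square := Square { sq_x : R ; sq_y : R ; sq_side : R }.

Definition unit_square : square := Square 0 0 1.

Definition square_set (Q : square) : set (R * R) :=
  `[sq_x Q, sq_x Q + sq_side Q] `*` `[sq_y Q, sq_y Q + sq_side Q].

(* The k-adic grid of Q is [set subsquare Q q | q in setT]; for sq_side Q > 0
   subsquare Q is injective, so that a uniform element of the grid is the same
   as a uniform q. *)
Definition subsquare (k : nat) (Q : square) (q : 'I_k * 'I_k) : square :=
  let side := sq_side Q / k%:R in
  Square (sq_x Q + q.1%:R * side) (sq_y Q + q.2%:R * side) side.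

End squares.
Arguments square : clear implicits.

(* Below, sequences are indexed from 0: M n and N n stand for M_{n+1} and
   N_{n+1}. *)

(* The index set {1, ..., P_n} of the n-th tuple of squares, as a tree: (j, i)
   is the i-th child of j. *)
Fixpoint address (N : nat -> nat) (n : nat) : finType :=
  if n is m.+1 then (address N m * 'I_(N m))%type else unit.

Lemma card_address (N : nat -> nat) (n : nat) :
  #|address N n| = (\prod_(i < n) N i)%N.
Proof.
elim: n => [|n IH]; first by rewrite big_ord0 card_unit.
by rewrite big_ord_recr /= card_prod card_ord IH.
Qed.

(* c n j is the position, in the grid of the parent square, of the square of
   index j in the (n+1)-st tuple. *)
Definition choices (M N : nat -> nat) :=
  forall n : nat, address N n.+1 -> 'I_(M n) * 'I_(M n).

Section cantor.
Context {R : realType} (M N : nat -> nat) (c : choices M N).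

Fixpoint cantor_square (n : nat) : address N n -> square R :=
  match n with
  | 0 => fun=> unit_square
  | m.+1 => fun j => subsquare (cantor_square j.1) (c j)
  end.

(* The intersection is over the tuples of squares of rank n >= 1. *)
Definition cantor_set : set (R * R) :=
  \bigcap_(n in [set: nat])
    \bigcup_(j in [set: address N n.+1]) square_set (cantor_square j).

End cantor.

Section random.
Context {d : measure_display} {Omega : measurableType d} {R : realType}.

(* Mutual independence of random elements with values in the discrete spaces
   T i (all subsets of T i are events). *)
Definition mutually_independent (P : probability Omega R) (I : eqType)
    (T : I -> Type) (X : forall i, Omega -> T i) : Prop :=
  forall (J : seq I) (A : forall i, set (T i)), uniq J ->
    P (\bigcap_(i in [set` J]) (X i @^-1` A i)) =
    (\prod_(i <- J) P (X i @^-1` A i))%E.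

Record random_choices (P : probability Omega R) (M N : nat -> nat)
    (X : forall n : nat, address N n.+1 -> Omega -> 'I_(M n) * 'I_(M n)) :
    Prop := RandomChoices {
  choices_measurable : forall n j q, measurable (X n j @^-1` [set q]) ;
  choices_uniform : forall n j q,
    P (X n j @^-1` [set q]) = ((M n)%:R ^- 2)%:E ;
  choices_independent :
    mutually_independent P
      (fun i : {n : nat & address N n.+1} => X (tag i) (tagged i)) }.

End random.

(* The random Cantor set F(omega). *)
Definition random_cantor_set {R : realType} {Omega : Type} (M N : nat -> nat)
    (X : forall n : nat, address N n.+1 -> Omega -> 'I_(M n) * 'I_(M n))
    (omega : Omega) : set (R * R) :=
  cantor_set (fun n j => X n j omega).

(* Main.v *)
Require Import Defs.
From mathcomp Require Import all_boot all_order all_algebra.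
From mathcomp Require Import all_classical all_reals all_analysis.
From mathcomp Require Import ring lra.
Import Order.TTheory GRing.Theory Num.Theory.
Import numFieldNormedType.Exports.
Set Implicit Arguments.
Unset Strict Implicit.
Unset Printing Implicit Defensive.
Local Open Scope classical_set_scope.
Local Open Scope ring_scope.

(** Write r_n for the side length and P_n for the number of squares of rank n.

    Upper bound, for every outcome.  The projected squares of rank n cover the
    projection of F by P_n sets of diameter at most 2 r_n, and the definition of
    s gives P_n r_n^t -> 0 along a subsequence as soon as t > s
    ([hausdorff_dim_proj_le], [small_cover_sum]).

    Lower bound, for t < s' < s, almost surely.  A set of diameter w in the
    line l pulls back to a strip of width about w orthogonal to l, so it is enough
    to find a random K such that every strip of every dyadic width w = 2^-m meets
    at most K w^t P_n squares of rank n, where n is the first rank with r_n <= w.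
    Indeed a cover of the projection with a small sum of t-th powers would then
    eliminate at most half of the squares of each rank; by Koenig's lemma
    an infinite branch of squares is never eliminated, and the point of F that it
    defines has an uncovered projection ([avoiding_branch_family],
    [hausdorff_measure_proj_neq0]).

    For one strip the count is controlled by a martingale.  Let h(Q) be the
    proportion of the grid squares of rank n inside Q that meet the strip
    ([avg_hit]).  The mean of h over the grid of Q is h(Q), with no loss of
    constants, and h(Q) is at most 11 w / r_k for Q of rank k < n, because each
    column of Q meets the strip in a bounded length ([avg_hit_le]).  Descending
    from rank n to rank 0, a Chernoff argument bounds the exponential moment of
    theta / P_n times the number of squares met, provided that theta times the sum
    over k <= n of (sup h) / P_k is small ([total_hit_moment]).  Since s' < 1 and
    P_k >= c r_k^-s', that sum is geometric and of order w^s'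
    ([sum_mean_bound]); this is where s < 1 is used.  So theta can be
    taken of order w^-s', and the probability that the count exceeds a large
    multiple of m w^s' P_n is at most a constant times 8^-m
    ([strip_count_tail]).  There are only O(4^m) strips of width 2^-m up to an
    error of order 2^-m, so Borel-Cantelli applies to all of them at once
    ([ae_strip_count]); and m w^s' is at most a constant times w^t. *)

(** * Side lengths and positions of the squares *)

Lemma half_expn_small (R : realType) (w : R) : 0 < w -> exists n, 2 ^- n <= w.
Proof.
move=> w0; exists (Num.bound w^-1); rewrite invf_ple ?posrE ?exprn_gt0//.
apply/ltW/(lt_le_trans (archi_boundP _)); first by rewrite invr_ge0 ltW.
by rewrite -natrX ler_nat ltnW// ltn_expl.
Qed.

Section scales.
Context {R : realType} (M N : nat -> nat).
Hypothesis hM : forall n, (2 <= M n)%N.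

Definition scale n : R := (\prod_(i < n) (M i)%:R)^-1.

Let M_ge2 n : 2 <= (M n)%:R :> R.
Proof. by rewrite (ler_nat R 2). Qed.

Let M_gt0 n : 0 < (M n)%:R :> R.
Proof. exact: lt_le_trans (M_ge2 n). Qed.

Lemma scale0 : scale 0 = 1.
Proof. by rewrite /scale big_ord0 invr1. Qed.

Lemma scaleS n : scale n.+1 = scale n / (M n)%:R.
Proof. by rewrite /scale big_ord_recr /= invfM. Qed.

Lemma scale_gt0 n : 0 < scale n.
Proof. by rewrite /scale invr_gt0 prodr_gt0. Qed.

Lemma scaleS_le n : scale n.+1 <= scale n / 2.
Proof.
by rewrite scaleS ler_pM2l ?scale_gt0// lef_pV2 ?posrE.
Qed.

Lemma scale_le k n : (k <= n)%N -> scale n <= scale k / 2 ^+ (n - k).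
Proof.
move=> /subnK; move: (n - k)%N => e <-.
elim: e => [|e IH]; first by rewrite expr0 divr1.
rewrite addSn exprSr invfM mulrA; apply: le_trans (scaleS_le _) _.
by rewrite ler_pM2r// invr_gt0.
Qed.

Lemma scale_le_half n : scale n <= 2 ^- n.
Proof. by have := scale_le (leq0n n); rewrite scale0 subn0 mul1r. Qed.

Lemma scale_small (w : R) : 0 < w -> exists n, scale n <= w.
Proof.
move=> /half_expn_small[n hn].
by exists n; exact: le_trans (scale_le_half n) hn.
Qed.

Section squares.
Variable c : choices M N.

Lemma cantor_square_side n (j : address N n) :
  sq_side (cantor_square (R := R) c j) = scale n.
Proof.
by elim: n j => [|n IH] j /=; rewrite ?scale0 ?scaleS ?IH.
Qed.

Let sub_le n (q : 'I_(M n)) : 0 <= q%:R * scale n.+1 /\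
  q%:R * scale n.+1 + scale n.+1 <= scale n.
Proof.
split; first by rewrite mulr_ge0// ltW// scale_gt0.
rewrite -[X in _ + X]mul1r -mulrDl natr1 scaleS mulrA ler_pdivrMr//.
by rewrite mulrC ler_pM2l ?scale_gt0// ler_nat.
Qed.

Lemma cantor_square_child n (j : address N n.+1) :
  let Q := cantor_square (R := R) c j in
  let Q' := cantor_square (R := R) c j.1 in
  (sq_x Q' <= sq_x Q /\ sq_x Q + scale n.+1 <= sq_x Q' + scale n) /\
  (sq_y Q' <= sq_y Q /\ sq_y Q + scale n.+1 <= sq_y Q' + scale n).
Proof.
rewrite /= cantor_square_side -scaleS.
have [? ?] := sub_le (c j).1; have [? ?] := sub_le (c j).2.
by split; split; lra.
Qed.

Lemma cantor_square_unit n (j : address N n) :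
  let Q := cantor_square (R := R) c j in
  (0 <= sq_x Q /\ sq_x Q + scale n <= 1) /\
  (0 <= sq_y Q /\ sq_y Q + scale n <= 1).
Proof.
elim: n j => [|n IH] j; first by rewrite /= scale0; split; split; lra.
move: (IH j.1) (cantor_square_child j) => /=.
move=> [[? ?] [? ?]] [[? ?] [? ?]]; split; split; lra.
Qed.

End squares.

End scales.

(** * The proportion of grid squares that meet a strip *)

Section average.
Context {R : realType} (M : nat -> nat).
Hypothesis hM : forall n, (2 <= M n)%N.
Context (rho x0 : R).

Let M_gt0 n : 0 < (M n)%:R :> R.
Proof. by rewrite ltr0n ltnW. Qed.

(** A strip is [|a x + b y - x0| <= rho] and [z] is the value of [a x + b y] at the
    lower left corner of a square of rank [k].  The value is the proportion,
    among the squares obtained by [d] successive grid subdivisions, of those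
    whose corner is in the strip. *)
Fixpoint avg_hit (a b : R) (d k : nat) (z : R) : R :=
  if d is d'.+1 then
    (M k)%:R ^- 2 * \sum_(q : 'I_(M k) * 'I_(M k))
       avg_hit a b d' k.+1 (z + (q.1%:R * a + q.2%:R * b) * scale M k.+1)
  else (`|z - x0| <= rho)%R%:R.

Lemma avg_hitS a b d k z : avg_hit a b d.+1 k z =
  (M k)%:R ^- 2 * \sum_(q : 'I_(M k) * 'I_(M k))
     avg_hit a b d k.+1 (z + (q.1%:R * a + q.2%:R * b) * scale M k.+1).
Proof. by []. Qed.

Lemma avg_hit_ge0 a b d k z : 0 <= avg_hit a b d k z.
Proof.
elim: d k z => [|d IH] k z //=.
by rewrite mulr_ge0 ?invr_ge0 ?sqr_ge0// sumr_ge0// => q _; exact: IH.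
Qed.

Lemma avg_hit_le1 a b d k z : avg_hit a b d k z <= 1.
Proof.
elim: d k z => [|d IH] k z /=; first by rewrite lern1 leq_b1.
rewrite mulrC ler_pdivrMr ?exprn_gt0// mul1r.
apply: le_trans (ler_sum _ (fun q _ => IH _ _)) _.
by rewrite sumr_const card_prod card_ord natrM expr2.
Qed.

Lemma avg_hit_swap a b d k z : avg_hit a b d k z = avg_hit b a d k z.
Proof.
elim: d k z => [|d IH] k z //=; congr (_ * _).
rewrite -(pair_bigA_idem _ (fun q1 q2 => avg_hit a b d k.+1
  (z + ((q1 : 'I__)%:R * a + (q2 : 'I__)%:R * b) * scale M k.+1)))/=;
  last by rewrite addr0.
rewrite exchange_big/= pair_bigA/=.
by apply: eq_bigr => -[q1 q2] _ /=; rewrite IH addrC [in RHS]addrC (addrC (_ * a)).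
Qed.

Let clamp (t u v : R) := Num.max u (Num.min t v).

Let clampP t u v : u <= v -> [\/ t <= u /\ clamp t u v = u,
  (u <= t /\ t <= v) /\ clamp t u v = t | v <= t /\ clamp t u v = v].
Proof.
rewrite /clamp => uv; case: (leP t v) => tv; last first.
  by apply: Or33; split; [exact: ltW|exact/max_idPr].
case: (leP u t) => ut; first by apply: Or32.
by apply: Or31; split => //; exact: ltW.
Qed.

(** Multiplied by [r], each indicator is at most the increment over
    [[t, t + r]] of the projection onto [[x0 - rho, x0 + rho + r]], and these
    increments telescope. *)
Lemma sum_indicator_le (r z : R) m : 0 < r -> 0 <= rho ->
  \sum_(i < m) (`|z + i%:R * r - x0| <= rho)%R%:R <= (2 * rho + r) / r :> R.
Proof.
move=> r0 rho0; rewrite ler_pdivlMr// mulr_suml.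
pose G t := clamp t (x0 - rho) (x0 + rho + r).
have step i : (`|z + i%:R * r - x0| <= rho)%R%:R * r <=
              G (z + i.+1%:R * r) - G (z + i%:R * r).
  rewrite /G -(natr1 i) mulrDl mul1r addrA; move: (z + _) => t.
  have uv : x0 - rho <= x0 + rho + r by lra.
  case: (clampP t uv) => -[? ->]; case: (clampP (t + r) uv) => -[? ->];
    case: (lerP `|t - x0| rho) => [/ler_normlP[h1 h2]|_];
    rewrite ?mul1r ?mul0r; lra.
apply: (@le_trans _ _ (\sum_(i < m) (G (z + i.+1%:R * r) - G (z + i%:R * r)))).
  by apply: ler_sum => i _; exact: step.
rewrite -(big_mkord xpredT (fun i => G (z + i.+1%:R * r) - G (z + i%:R * r))).
rewrite telescope_sumr// /G.
have uv : x0 - rho <= x0 + rho + r by lra.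
by case: (clampP (z + m%:R * r) uv) => -[? ->]; 
  case: (clampP (z + 0%:R * r) uv) => -[? ->]; lra.
Qed.

(** The bound on a single square does not survive averaging, but the bound on
    a whole stack of squares does: subdividing a stack of [m] squares gives
    [M k] stacks of [m * M k] squares. *)
Lemma sum_avg_hit_le a d k z m (L : R) : 0 <= rho ->
  2 * rho + scale M (d + k) <= L ->
  \sum_(i < m) avg_hit a 1 d k (z + i%:R * scale M k) <= L / scale M k.
Proof.
move=> rho0; elim: d k z m => [|d IH] k z m hL.
  apply: le_trans (sum_indicator_le _ _ (scale_gt0 hM k) rho0) _.
  by rewrite ler_pM2r// invr_gt0 scale_gt0.
have M0 := M_gt0 k.
rewrite /= -mulr_sumr.
under eq_bigr => i _.
  rewrite -(pair_bigA_idem _ (fun q1 q2 => avg_hit a 1 d k.+1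
    (z + i%:R * scale M k +
     ((q1 : 'I__)%:R * a + (q2 : 'I__)%:R * 1) * scale M k.+1)))/=;
    last by rewrite addr0.
  over.
rewrite exchange_big/=.
rewrite mulrC ler_pdivrMr ?exprn_gt0//.
apply: (@le_trans _ _ (\sum_(q1 < M k) L / scale M k.+1)).
  apply: ler_sum => q1 _.
  have := IH k.+1 (z + q1%:R * a * scale M k.+1) (m * M k)%N; rewrite addnS => /(_ hL).
  apply: le_trans; rewrite -(big_mkord xpredT (fun i => avg_hit a 1 d k.+1
     (z + q1%:R * a * scale M k.+1 + i%:R * scale M k.+1))).
  rewrite big_nat_mul big_mkord le_eqVlt; apply/orP; left; apply/eqP.
  apply: eq_bigr => i _; rewrite mulSn -{1}[(i * M k)%N]add0n big_addn addnK.
  rewrite big_mkord; apply: eq_bigr => q2 _; congr avg_hit.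
  rewrite scaleS natrD natrM; field; exact: lt0r_neq0.
rewrite sumr_const card_ord scaleS -mulr_natr le_eqVlt; apply/orP; left; apply/eqP.
by field; rewrite !lt0r_neq0 ?scale_gt0.
Qed.

Lemma avg_hit_le a b d k z (L : R) : a = 1 \/ b = 1 -> 0 <= rho ->
  2 * rho + scale M (d + k) <= L -> avg_hit a b d k z <= L / scale M k.
Proof.
have main e : 0 <= rho ->
    2 * rho + scale M (d + k) <= L -> avg_hit e 1 d k z <= L / scale M k.
  move=> rho0 hL; have := sum_avg_hit_le e z 1 rho0 hL.
  by rewrite big_ord1 mul0r addr0.
by move=> -[->|->]; last exact: main; rewrite avg_hit_swap; exact: main.
Qed.

End average.

(** * Exponential moments of the number of squares met *)

Section configurations.
Context {R : realType} (M N : nat -> nat).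
Hypothesis hM : forall n, (2 <= M n)%N.
Hypothesis hN0 : forall n, (0 < N n)%N.

(** The choices made in the first [n] steps: a finite type, so that moments of
    functions of these choices are finite sums. *)
Fixpoint config n : finType :=
  if n is m.+1 then
    (config m * {ffun address N m.+1 -> 'I_(M m) * 'I_(M m)})%type
  else unit.

Fixpoint config_of (c : choices M N) n : config n :=
  match n with
  | 0 => tt
  | m.+1 => (config_of c m, [ffun j => c m j])
  end.

Fixpoint config_square n : config n -> address N n -> square R :=
  match n with
  | 0 => fun _ _ => unit_square
  | m.+1 => fun f j => subsquare (config_square f.1 j.1) (f.2 j)
  end.

Lemma cantor_square_config c n (j : address N n) :
  cantor_square c j = config_square (config_of c n) j.
Proof. by elim: n j => [|n IH] j //=; rewrite IH ffunE. Qed.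

Lemma config_square_side n (f : config n) j :
  sq_side (config_square f j) = scale M n.
Proof. by elim: n f j => [|n IH] f j /=; rewrite ?scale0 ?scaleS ?IH. Qed.

(** All configurations of [n] steps have this probability. *)
Fixpoint config_weight n : R :=
  if n is m.+1 then config_weight m * ((M m)%:R ^- 2) ^+ #|address N m.+1|
  else 1.

Lemma config_weight_ge0 n : 0 <= config_weight n.
Proof.
by elim: n => [|n IH] //=; rewrite mulr_ge0// exprn_ge0// invr_ge0 sqr_ge0.
Qed.

Definition expectation n (phi : config n -> R) : R :=
  config_weight n * \sum_(f : config n) phi f.

Lemma le_expectation n (phi psi : config n -> R) :
  (forall f, phi f <= psi f) -> expectation phi <= expectation psi.
Proof. by move=> h; rewrite ler_wpM2l ?config_weight_ge0// ler_sum. Qed.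

Lemma markov_config n (A : {set config n}) (phi : config n -> R) (K : R) :
  (forall f, 0 <= phi f) -> (forall f, f \in A -> K <= phi f) ->
  config_weight n * #|A|%:R * K <= expectation phi.
Proof.
move=> phi0 hA; rewrite -mulrA ler_wpM2l ?config_weight_ge0//.
rewrite mulr_natl -sumr_const big_mkcond/=.
by apply: ler_sum => f _; case: ifPn => // /hA.
Qed.

Definition corner (a b : R) (Q : square R) : R := a * sq_x Q + b * sq_y Q.

Lemma expR_le_quadratic (x : R) : 0 <= x -> x <= 2^-1 ->
  expR x <= 1 + x + 2 * x ^+ 2.
Proof.
move=> x0 x1; have e0 := expR_gt0 x.
have h : expR x * (1 - x) <= 1.
  rewrite -[leRHS](expRxMexpNx_1 x) ler_pM2l//.
  by apply: le_trans (expR_ge1Dx _).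
have p : 0 < 1 - x by lra.
rewrite -(ler_pM2r p); apply: le_trans h _; nra.
Qed.

Section moment.
Context (rho x0 a b : R).

Let h := avg_hit M rho x0 a b.

Definition total_hit d n (f : config n) : R :=
  \sum_(j : address N n) h d n (corner a b (config_square f j)).

Lemma avg_expR_le d k z (lambda B : R) : 0 <= lambda -> lambda * B <= 2^-1 ->
  (forall z', h d k.+1 z' <= B) ->
  \sum_(q : 'I_(M k) * 'I_(M k)) (M k)%:R ^- 2 *
    expR (lambda * h d k.+1 (z + (q.1%:R * a + q.2%:R * b) * scale M k.+1)) <=
  expR (lambda * (1 + 2 * (lambda * B)) * h d.+1 k z).
Proof.
move=> l0 lB hB; apply: le_trans (expR_ge1Dx _).
have M0 : 0 < (M k)%:R :> R by rewrite ltr0n (leq_trans _ (hM k)).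
rewrite /h avg_hitS mulrCA !mulr_sumr -/h.
have w1 : 1 = \sum_(q : 'I_(M k) * 'I_(M k)) (M k)%:R ^- 2 :> R.
  rewrite sumr_const card_prod card_ord -[RHS]mulr_natr natrM -expr2 mulVf//.
  by rewrite expf_neq0 ?lt0r_neq0.
rewrite [X in _ <= X + _]w1 -big_split/=; apply: ler_sum => q _.
rewrite -{2}[_ ^- 2]mulr1 -mulrDr ler_pM2l ?invr_gt0 ?exprn_gt0//.
set y := h _ _ _.
have y0 : 0 <= y by exact: avg_hit_ge0.
have yB : y <= B by exact: hB.
have lyB : lambda * y <= lambda * B by rewrite ler_wpM2l.
have ly0 : 0 <= lambda * y by rewrite mulr_ge0.
apply: le_trans (expR_le_quadratic ly0 (le_trans lyB lB)) _.
by nra.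
Qed.

(** Conditioning on the first [k] steps: the children are independent, so the
    moment factors over them, and the parameter of the exponential grows by the
    number of children times a factor close to 1. *)
Lemma total_hit_step d k (B lambda : R) : 0 <= lambda -> lambda * B <= 2^-1 ->
  (forall z', h d k.+1 z' <= B) ->
  expectation (fun f : config k.+1 => expR (lambda * total_hit d f)) <=
  expectation (fun f : config k =>
    expR ((N k)%:R * lambda * (1 + 2 * (lambda * B)) * total_hit d.+1 f)).
Proof.
move=> l0 lB hB; rewrite /expectation /= -mulrA.
rewrite ler_wpM2l ?config_weight_ge0//.
rewrite -(pair_bigA_idem _ (fun (f : config k) g =>
  expR (lambda * @total_hit d k.+1 (f, g))))/=; last by rewrite addr0.
rewrite mulr_sumr; apply: ler_sum => f _.
pose F (j : address N k.+1) (q : 'I_(M k) * 'I_(M k)) := (M k)%:R ^- 2 *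
  expR (lambda * h d k.+1 (corner a b (config_square f j.1) +
    (q.1%:R * a + q.2%:R * b) * scale M k.+1)).
(* Independence of the children: a sum over choice functions of a product. *)
have -> : (M k)%:R ^- 2 ^+ #|address N k.+1| *
    (\sum_g expR (lambda * @total_hit d k.+1 (f, g))) =
    \prod_(j : address N k.+1) \sum_q F j q.
  rewrite bigA_distr_bigA mulr_sumr; apply: eq_bigr => g _.
  rewrite big_split/= prodr_const; congr (_ * _).
  rewrite /total_hit mulr_sumr expR_sum; apply: eq_bigr => j _.
  congr (expR (_ * h _ _ _)); rewrite /corner /=.
  by rewrite config_square_side -scaleS; ring.
apply: (@le_trans _ _ (\prod_(j : address N k.+1)
    expR (lambda * (1 + 2 * (lambda * B)) *
      h d.+1 k (corner a b (config_square f j.1))))).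
  apply: ler_prod => j _; rewrite sumr_ge0; last first.
    by move=> q _; rewrite mulr_ge0 ?expR_ge0// invr_ge0 sqr_ge0.
  by rewrite /F/=; exact: avg_expR_le.
rewrite -expR_sum ler_expR -mulr_sumr.
rewrite -(pair_bigA_idem _ (fun (j : address N k) (i : 'I_(N k)) =>
  h d.+1 k (corner a b (config_square f j))))/=; last by rewrite addr0.
under eq_bigr do rewrite sumr_const card_ord -mulr_natl.
by rewrite -mulr_sumr /total_hit le_eqVlt; apply/orP; left; apply/eqP; ring.
Qed.

Variables (T : R) (B : nat -> R).
Hypothesis B0 : forall i, 0 <= B i.

(** A bound on the contribution of one square of rank [i] to the mean of the
    final proportion. *)
Definition mean_bound i : R := B i / #|address N i|%:R.

(** Iterating the previous step multiplies the factors close to 1.  The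
    parameters stay below [T], which makes their growth additive: step [i]
    adds at most [2 * T ^+ 2 * mean_bound i]. *)
Lemma total_hit_moment k d (theta : R) : 0 <= theta ->
  theta + 2 * T ^+ 2 * \sum_(i < k) mean_bound i.+1 <= T ->
  (forall i, (0 < i <= k)%N -> T * mean_bound i <= 2^-1) ->
  (forall i d' z, (0 < i <= k)%N -> (d' + i = d + k)%N -> h d' i z <= B i) ->
  expectation (fun f : config k =>
     expR (theta / #|address N k|%:R * total_hit d f)) <=
  expR ((theta + 2 * T ^+ 2 * \sum_(i < k) mean_bound i.+1) * h (d + k) 0 0).
Proof.
elim: k d theta => [|k IH] d theta theta0.
  move=> _ _ _; rewrite /expectation /= mul1r big_ord0 mulr0 addr0 addn0.
  rewrite (big_pred1 tt)/=; last by case.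
  rewrite card_unit divr1 ler_expR /total_hit (big_pred1 tt)/=; last by case.
  by rewrite /corner /= !mulr0 addr0.
move=> hT hb hB; have P0 : 0 < #|address N k.+1|%:R :> R.
  by rewrite ltr0n card_address prodn_gt0.
have m0 i : 0 <= mean_bound i by rewrite divr_ge0.
have S0 : 0 <= \sum_(i < k) mean_bound i.+1 by rewrite sumr_ge0.
rewrite big_ord_recr /= in hT *.
set S := \sum_(i < k) _ in S0 hT *.
have hbk : T * mean_bound k.+1 <= 2^-1 by apply: hb; rewrite ltnS leqnn.
set m := mean_bound k.+1 in hT hbk *.
have thT : theta <= T.
  apply: le_trans hT; rewrite lerDl mulr_ge0//.
    by rewrite mulr_ge0// sqr_ge0.
  by rewrite addr_ge0//; exact: m0.
have T0 := le_trans theta0 thT.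
have lBE : theta / #|address N k.+1|%:R * B k.+1 = theta * m.
  by rewrite /m /mean_bound; ring.
apply: le_trans (@total_hit_step d k (B k.+1) _ _ _ _) _.
- by rewrite divr_ge0.
- by rewrite lBE; apply: le_trans hbk; apply: ler_wpM2r; first exact: m0.
- by move=> z; apply: hB; rewrite ?ltnS ?leqnn.
rewrite lBE; set theta' := theta + 2 * T ^+ 2 * m.
have thE : theta + 2 * T ^+ 2 * (S + m) = theta' + 2 * T ^+ 2 * S.
  by rewrite /theta'; ring.
rewrite thE in hT *.
have th' : theta * (1 + 2 * (theta * m)) <= theta'.
  have : theta ^+ 2 * m <= T ^+ 2 * m.
    by apply: ler_wpM2r; [exact: m0|rewrite ler_sqr].
  by rewrite /theta'; nra.
have PE : #|address N k.+1|%:R = #|address N k|%:R * (N k)%:R :> R.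
  by rewrite /= card_prod card_ord natrM.
apply: (@le_trans _ _ (expectation (fun f : config k =>
    expR (theta' / #|address N k|%:R * total_hit d.+1 f)))).
  apply: le_expectation => f; rewrite ler_expR ler_wpM2r//.
    by rewrite sumr_ge0// => j _; exact: avg_hit_ge0.
  rewrite PE.
  rewrite PE in P0.
  have Nk : (N k)%:R != 0 :> R by rewrite pnatr_eq0 -lt0n.
  have Pk : #|address N k|%:R != 0 :> R.
    by apply: contraTneq P0 => ->; rewrite mul0r ltxx.
  have -> : (N k)%:R * (theta / (#|address N k|%:R * (N k)%:R)) *
     (1 + 2 * (theta * m)) = theta * (1 + 2 * (theta * m)) / #|address N k|%:R.
    by field; rewrite Nk Pk.
  by rewrite ler_pM2r// invr_gt0 lt0r Pk ler0n.
rewrite -addSnnS; apply: IH.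
- by apply: le_trans th'; rewrite mulr_ge0// addr_ge0// !mulr_ge0//; exact: m0.
- exact: hT.
- by move=> i /andP[i0 ik]; apply: hb; rewrite i0 (leq_trans ik).
- move=> i d' z /andP[i0 ik] e; apply: hB; first by rewrite i0 (leq_trans ik).
  by rewrite e addSnnS.
Qed.

End moment.
End configurations.

(** * The law of the first choices *)

Section law.
Context {R : realType} (M N : nat -> nat).
Hypothesis hM : forall n, (2 <= M n)%N.
Context (d : measure_display) (Omega : measurableType d)
  (P : probability Omega R)
  (X : forall n : nat, address N n.+1 -> Omega -> 'I_(M n) * 'I_(M n)).
Hypothesis hX : random_choices P X.

Definition sample (w : Omega) : choices M N := fun n j => X j w.

Fixpoint indices n : seq {k & address N k.+1} :=
  if n is m.+1 then
    indices m ++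
    [seq Tagged (fun k => address N k.+1) j | j <- enum (address N m.+1)]
  else [::].

Lemma mem_indices n (i : {k & address N k.+1}) : (i \in indices n) = (tag i < n)%N.
Proof.
elim: n => [|n IH] //=; rewrite mem_cat IH ltnS (leq_eqVlt (tag i)) orbC; congr orb.
apply/mapP/eqP => [[j _ ->]//|]; case: i {IH} => k j /= e.
by case: _ / e j => j; exists j => //; rewrite mem_enum.
Qed.

Lemma indices_uniq n : uniq (indices n).
Proof.
elim: n => [|n IH] //=; rewrite cat_uniq IH /=; apply/andP; split.
  apply/hasPn => _ /mapP[j _ ->].
  by rewrite (mem_indices n (Tagged (fun k => address N k.+1) j)) ltnn.
rewrite map_inj_in_uniq ?enum_uniq// => j j' _ _ /eqP.
by rewrite eq_Tagged => /eqP.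
Qed.

Lemma prod_indices n :
  \prod_(i <- indices n) ((M (tag i))%:R ^- 2) = config_weight (R := R) M N n.
Proof.
elim: n => [|n IH] /=; first by rewrite big_nil.
by rewrite big_cat/= IH big_map big_enum/= prodr_const.
Qed.

Lemma config_of_eq n (c c' : choices M N) :
  config_of c n = config_of c' n <->
  forall k (j : address N k.+1), (k < n)%N -> c k j = c' k j.
Proof.
elim: n => [|n IH] /=; first by split.
split => [[/IH h /ffunP g] k j|h].
  rewrite ltnS (leq_eqVlt k) => /predU1P[kn|]; last exact: h.
  by case: _ / (esym kn) j => j; have := g j; rewrite !ffunE.
congr pair; first by apply/IH => k j kn; apply: h; exact: ltnW.
by apply/ffunP => j; rewrite !ffunE; exact: h.
Qed.

Let dflt : choices M N :=
  fun n _ => (Ordinal (ltnW (hM n)), Ordinal (ltnW (hM n))).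

(** Completes a configuration by default choices at the later steps: mutual
    independence is stated for families of events indexed by all steps. *)
Fixpoint extend n : config M N n -> choices M N :=
  match n return config M N n -> choices M N with
  | 0 => fun=> dflt
  | m.+1 => fun f : config M N m.+1 =>
      @eqtype.dfwith _ (fun k => address N k.+1 -> 'I_(M k) * 'I_(M k))%type
        (extend (n := m) f.1) m (fun j => f.2 j)
  end.

Lemma extendK n (f : config M N n) : config_of (extend f) n = f.
Proof.
elim: n f => [|n IH] /=; first by case.
move=> [f g] /=; congr pair; last first.
  by apply/ffunP => j; rewrite ffunE eqtype.dfwith_in.
rewrite -[RHS]IH; apply/config_of_eq => k j kn.
by rewrite eqtype.dfwith_out// gtn_eqF.
Qed.

Let event n (f : config M N n) : set Omega :=
  [set w | config_of (sample w) n = f].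

Let eventE n (f : config M N n) : event f =
  \bigcap_(i in [set` indices n]) (X (tagged i) @^-1` [set extend f (tagged i)]).
Proof.
rewrite /event -{1}(extendK f); apply/seteqP; split => w /=.
  by move=> /config_of_eq h i /=; rewrite mem_indices => /h; exact.
move=> h; apply/config_of_eq => k j kn.
by apply: (h (Tagged (fun k => address N k.+1) j)); rewrite /= mem_indices.
Qed.

Let measurable_event n (f : config M N n) : measurable (event f).
Proof.
rewrite eventE; apply: fin_bigcap_measurable.
  by apply/finite_seqP; exists (indices n).
by move=> i _; exact: (choices_measurable hX).
Qed.

Let probability_event n (f : config M N n) :
  P (event f) = (config_weight M N n)%:E.
Proof.
rewrite eventE (choices_independent hX (fun i => [set extend f (tagged i)]))//;
  last exact: indices_uniq.
rewrite -prod_indices -prodEFin; apply: eq_bigr => i _.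
exact: (choices_uniform hX).
Qed.

Lemma probability_config n (A : {set config M N n}) :
  measurable [set w | config_of (sample w) n \in A] /\
  (P [set w | config_of (sample w) n \in A] <=
    (config_weight M N n * #|A|%:R)%:E)%E.
Proof.
rewrite cardE.
rewrite (_ : [set w | _] = [set w | config_of (sample w) n \in enum A]); last first.
  by apply/seteqP; split => w /=; rewrite mem_enum.
elim: (enum A) => [|f s [ms ls]].
  rewrite (_ : [set w | _] = set0); last by apply/seteqP; split.
  by rewrite measure0 mulr0.
rewrite (_ : [set w | _] = event f `|` [set w | config_of (sample w) n \in s]).
  split; first exact: measurableU.
  apply: le_trans (measureU2 _ _ _) _ => //.
  by rewrite /= -addn1 natrD mulrDr addrC mulr1 EFinD probability_event leeD.
apply/seteqP; split => w /=; rewrite inE.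
  by case/predU1P => ?; [left|right].
by case=> [->|->]; rewrite ?eqxx ?orbT.
Qed.

End law.

(** Borel-Cantelli with a geometric bound. *)
Lemma ae_eventually_not {R : realType} (d : measure_display)
    (Omega : measurableType d) (P : probability Omega R)
    (E : nat -> set Omega) (C : R) :
  0 <= C -> (forall m, measurable (E m)) ->
  (forall m, (P (E m) <= (C * 2 ^- m)%:E)%E) ->
  {ae P, forall w, exists m0, forall m, (m0 <= m)%N -> ~ E m w}.
Proof.
move=> C0 mE PE; exists (lim_sup_set E); split.
- by apply: bigcap_measurable; [exists 0%N|move=> n _; apply: bigcup_measurable].
- apply: lim_sup_set_cvg0 => //.
  apply: (@le_lt_trans _ _ (\sum_(0 <= m <oo) ((2 * C) / (2 ^ m.+1)%:R)%:E)%E).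
    apply: lee_nneseries => // m _; apply: le_trans (PE m) _.
    by rewrite lee_fin natrX exprS le_eqVlt; apply/orP; left; apply/eqP; field.
  have := epsilon_trick0 xpredT (mulr_ge0 (ler0n R 2) C0).
  by move=> /le_lt_trans; apply; rewrite ltry.
- move=> w /= h n _; apply: contrapT => hn; apply: h; exists n => m nm Em.
  by apply: hn; exists m.
Qed.

(** * The tail of the number of squares met by one strip *)

Section strips.
Context {R : realType} (M N : nat -> nat).
Hypothesis hM : forall n, (2 <= M n)%N.
Hypothesis hN0 : forall n, (0 < N n)%N.
(* [s1] is the exponent s' of the introduction. *)
Context (C0 s1 : R).
Hypotheses (s1_gt0 : 0 < s1) (s1_lt1 : s1 < 1).
Hypothesis hP : forall k,
  (#|address N k|%:R)^-1 <= C0 * scale (R := R) M k `^ s1.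

Let P_gt0 k : 0 < #|address N k|%:R :> R.
Proof. by rewrite ltr0n card_address prodn_gt0. Qed.

Let C0_ge1 : 1 <= C0.
Proof. by have := hP 0; rewrite scale0 powR1 mulr1 card_unit invr1. Qed.

Lemma sum_geometric_le (x : R) n : 0 <= x -> x < 1 ->
  \sum_(i < n) x ^+ i <= (1 - x)^-1.
Proof.
move=> x0 x1; have x2 : 0 < 1 - x by rewrite subr_gt0.
rewrite -div1r ler_pdivlMr// mulrC.
have <- : 1 - x ^+ n = (1 - x) * \sum_(i < n) x ^+ i.
  elim: n => [|n IH]; first by rewrite big_ord0 expr0; ring.
  by rewrite big_ord_recr/= mulrDr -IH exprSr; ring.
by rewrite gerBl exprn_ge0.
Qed.

Section one_scale.
Context (w : R) (n : nat).
Hypotheses (w_gt0 : 0 < w) (w_le1 : w <= 1) (hn : scale M n <= w)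
  (hn' : forall k, (k < n)%N -> w < scale M k).

(** An upper bound for [avg_hit] at rank [i]; here [11 = 2 * 5 + 1] accounts
    for a strip of half-width [5 * w] and one more square of side at most [w]. *)
Definition hit_bound i : R := if (i < n)%N then 11 * w / scale M i else 1.

Lemma hit_bound_ge0 i : 0 <= hit_bound i.
Proof.
rewrite /hit_bound; case: ifP => // _.
by rewrite divr_ge0// ?mulr_ge0// ltW// scale_gt0.
Qed.

Definition decay : R := 2 `^ (s1 - 1).
Definition sum_cst : R := C0 * (11 / (1 - decay) + 1).

Lemma decay_bounds : 0 < decay /\ decay < 1.
Proof.
split; first exact: powR_gt0.
  rewrite /decay /powR (negbTE (lt0r_neq0 _))// expR_lt1.
  by rewrite nmulr_rlt0 ?subr_lt0// ln_gt0// ltr1n.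
Qed.

Lemma sum_cst_ge1 : 1 <= sum_cst.
Proof.
have [x0 x1] := decay_bounds; apply: le_trans C0_ge1 _.
have C00 : 0 < C0 by apply: lt_le_trans C0_ge1.
by rewrite ler_peMr ?(ltW C00)// lerDr divr_ge0// subr_ge0 ltW.
Qed.

Lemma powR_shrink (u : R) e : 2 ^+ e * w <= u ->
  w / u * u `^ s1 <= w `^ s1 * decay ^+ e.
Proof.
move=> hu; have u0 : 0 < u by apply: lt_le_trans hu; rewrite mulr_gt0// exprn_gt0.
have -> : w / u * u `^ s1 = w * u `^ (s1 - 1).
  rewrite -(powR_inv1 (ltW u0)) -mulrA -powRD; first by rewrite addrC.
  by rewrite (lt0r_neq0 u0) implybT.
rewrite -(mulr_powRB1 (ltW w_gt0) s1_gt0) -mulrA ler_pM2l//.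
have -> : decay ^+ e = (2 ^+ e) `^ (s1 - 1).
  by rewrite /decay -powR_mulrn ?powR_ge0// -powRrM mulrC powRrM powR_mulrn.
rewrite [leRHS]mulrC -powRM ?exprn_ge0 ?(ltW w_gt0)//.
rewrite -opprB !powRN lef_pV2 ?posrE ?powR_gt0 ?mulr_gt0 ?exprn_gt0//.
apply: ge0_ler_powR => //; first by rewrite subr_ge0 ltW.
  by rewrite nnegrE mulr_ge0 ?exprn_ge0// ltW.
by rewrite nnegrE ltW.
Qed.

(** The terms of rank below [n] decrease geometrically away from [n], because
    [w / u * u `^ s1] is a negative power of [u] when [s1 < 1]; the term of
    rank [n] is at most [C0 * w `^ s1] since the side length is at most [w]. *)
Lemma sum_mean_bound :
  \sum_(i < n) mean_bound N hit_bound i.+1 <= sum_cst * w `^ s1.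
Proof.
have [x0 x1] := decay_bounds.
have C00 : 0 <= C0 by apply: le_trans C0_ge1.
have mean_le k : mean_bound N hit_bound k <= hit_bound k * (C0 * scale M k `^ s1).
  by rewrite ler_wpM2l ?hit_bound_ge0.
have [n0|[n' nE]] : n = 0%N \/ exists n', n = n'.+1.
  by case: (n) => [|k]; [left|right; exists k].
  rewrite n0 big_ord0 mulr_ge0 ?powR_ge0//.
  by apply: le_trans sum_cst_ge1.
rewrite nE big_ord_recr /= /sum_cst mulrDr mulr1 mulrDl; apply: lerD.
  apply: (@le_trans _ _ (\sum_(i < n') C0 * 11 * w `^ s1 * decay ^+ rev_ord i)).
    apply: ler_sum => i _; apply: le_trans (mean_le _) _.
    rewrite /hit_bound nE ltnS ltn_ord.
    have -> : 11 * w / scale M i.+1 * (C0 * scale M i.+1 `^ s1) =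
        C0 * 11 * (w / scale M i.+1 * scale M i.+1 `^ s1) by ring.
    rewrite -[leRHS]mulrA ler_wpM2l ?mulr_ge0//; apply: powR_shrink.
    rewrite mulrC -ler_pdivlMr ?exprn_gt0//= .
    apply: le_trans (scale_le hM (ltn_ord i)).
    by apply/ltW/hn'; rewrite nE.
  rewrite -mulr_sumr.
  rewrite (reindex_inj rev_ord_inj)/=.
  under eq_bigr => i _ do rewrite -[_ ^+ _]/(decay ^+ (rev_ord (rev_ord i))) rev_ordK.
  rewrite mulrAC mulrA ler_wpM2r ?powR_ge0//.
  by rewrite ler_wpM2l ?mulr_ge0// sum_geometric_le// ltW.
apply: le_trans (mean_le _) _; rewrite /hit_bound nE ltnn mul1r ler_wpM2l//.
by rewrite -nE ge0_ler_powR ?nnegrE// ?ltW// scale_gt0.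
Qed.

Definition strip_count (a b c : R) (f : config M N n) : nat :=
  #|[pred j : address N n | `|corner a b (config_square f j) - c| <= 5 * w]|.

Lemma total_hit_strip_count a b c (f : config M N n) :
  total_hit (5 * w) c a b 0 f = (strip_count a b c f)%:R.
Proof.
rewrite /strip_count -sum1_card natr_sum /total_hit big_mkcond [RHS]big_mkcond.
by apply: eq_bigr => j _ /=; rewrite inE /=; case: ifP.
Qed.

(** Markov's inequality for the exponential moment, with a parameter [theta]
    of order [w `^ - s1] for which the accumulated growth is at most a
    factor 2. *)
Lemma strip_count_tail a b c (m : nat) : a = 1 \/ b = 1 ->
  config_weight M N n *
    #|[set f : config M N n | 56 * sum_cst * m%:R * w `^ s1 * #|address N n|%:R
        < (strip_count a b c f)%:R]%SET|%:R <= expR 3 * 8 ^- m :> R.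
Proof.
move=> ab; have [x0 x1] := decay_bounds.
have L11 : 2 * (5 * w) + scale M n <= 11 * w by move: hn; lra.
have D1 := sum_cst_ge1; set D := sum_cst in D1 *.
have D0 : 0 < D by apply: lt_le_trans D1.
have W0 : 0 < w `^ s1 by exact: powR_gt0.
set A := finset _; pose theta := (8 * D * w `^ s1)^-1.
have DW0 : 0 < 8 * D * w `^ s1 by rewrite mulr_gt0// mulr_gt0.
have th0 : 0 < theta by rewrite invr_gt0.
set S := \sum_(i < n) mean_bound N hit_bound i.+1.
have mb0 i : 0 <= mean_bound N hit_bound i by rewrite divr_ge0 ?hit_bound_ge0.
have S0 : 0 <= S by apply: sumr_ge0 => i _; exact: mb0.
have SD : 8 * theta * S <= 1.
  rewrite mulrAC /theta.
  rewrite ler_pdivrMr// mul1r -mulrA.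
  by rewrite ler_pM2l//; exact: sum_mean_bound.
have avg_le i d' z : (d' + i = n)%N -> (i < n)%N ->
    avg_hit M (5 * w) c a b d' i z <= 11 * w / scale M i.
  move=> e _; apply: avg_hit_le => //; first by rewrite mulr_ge0// ltW.
  by rewrite e.
have T0 : theta + 2 * (2 * theta) ^+ 2 * S <= 2 * theta.
  by rewrite expr2; have := ler_wpM2l (ltW th0) SD; rewrite mulr1; nra.
have H := @total_hit_moment R M N hM hN0 (5 * w) c a b (2 * theta) hit_bound
   hit_bound_ge0 n 0 theta (ltW th0) T0.
have H1 : forall i, (0 < i <= n)%N -> 2 * theta * mean_bound N hit_bound i <= 2^-1.
  move=> [|i]// /andP[_ ilt].
  have : mean_bound N hit_bound i.+1 <= S.
    rewrite /S (bigD1 (Ordinal ilt))//= lerDl sumr_ge0//.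
  by move=> /(ler_wpM2l (ltW th0)) ?; nra.
have H2 : forall i d' z, (0 < i <= n)%N -> (d' + i = 0 + n)%N ->
    avg_hit M (5 * w) c a b d' i z <= hit_bound i.
  move=> i d' z /andP[_ ile] e; rewrite /hit_bound; case: ifPn => [il|_].
    exact: avg_le.
  exact: avg_hit_le1.
have {H1 H2} H := H H1 H2.
have {}H : expectation (fun f : config M N n => expR (theta / #|address N n|%:R *
      total_hit (5 * w) c a b 0 f)) <= expR 3.
  apply: le_trans H _; rewrite ler_expR.
  have h0 := avg_hit_ge0 M (5 * w) c a b (0 + n) 0 0.
  apply: le_trans (ler_wpM2r h0 T0) _.
  apply: (@le_trans _ _ (2 * theta * (11 * w))).
    apply: ler_wpM2l; first by rewrite mulr_ge0// ltW.
    apply: le_trans (@avg_hit_le R M hM (5 * w) c a b (0 + n) 0 0 (11 * w) ab _ _) _.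
    - by rewrite mulr_ge0// ltW.
    - by rewrite addn0 add0n.
    - by rewrite scale0 divr1.
  rewrite mulrAC /theta ler_pdivrMr//.
  have wW : w <= w `^ s1 by apply: ger1_powR; [rewrite w_gt0|exact: ltW].
  by nra.
have M8 : 8 ^+ m <= expR (7 * m%:R) :> R.
  by rewrite expRM_natr lerXn2r ?nnegrE ?expR_ge0//; apply: le_trans (expR_ge1Dx _); lra.
have MK := @markov_config R M N n A (fun f => expR (theta / #|address N n|%:R *
  total_hit (5 * w) c a b 0 f)) (expR (7 * m%:R)) (fun f => expR_ge0 _).
rewrite ler_pdivlMr ?exprn_gt0//.
apply: le_trans (le_trans (MK _) H) => /=.
  by rewrite ler_wpM2l// mulr_ge0// config_weight_ge0.
move=> f; rewrite inE ler_expR total_hit_strip_count => hf.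
rewrite [leRHS]mulrAC ler_pdivlMr// /theta [leRHS]mulrC ler_pdivlMr//.
by apply: le_trans (ltW hf); rewrite le_eqVlt; apply/orP; left; apply/eqP; ring.
Qed.

End one_scale.
End strips.

(** * All strips of dyadic width at once *)

Section strip_family.
Context {R : realType}.

(** A strip of scale [m]: the boolean tells which coordinate has coefficient 1,
    and the two indices are the grid values of the other coefficient and of
    the center, both in [[-4, 4[]. *)
Definition strip_index (m : nat) : finType :=
  (bool * ('I_(8 * 2 ^ m) * 'I_(8 * 2 ^ m)))%type.

Definition grid_point (m i : nat) : R := i%:R * 2 ^- m - 4.

Definition strip_form m (S : strip_index m) : R * R :=
  if S.1 then (grid_point m S.2.1, 1) else (1, grid_point m S.2.1).

Definition strip_center m (S : strip_index m) : R := grid_point m S.2.2.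

Definition strip_hits M N (c : choices M N) n m (S : strip_index m) :
    pred (address N n) :=
  [pred j | `|corner (strip_form S).1 (strip_form S).2 (cantor_square c j)
              - strip_center S| <= 5 * 2 ^- m].

Lemma powR_halfX (m : nat) (t : R) : (2 ^- m) `^ t = 2 `^ (- (m%:R * t)).
Proof. by rewrite -powR_invn// -powRrM mulNr. Qed.

(** The logarithmic loss [m] is absorbed by lowering the exponent:
    [x <= expR x] at [x = m * ((s - t) * ln 2)]. *)
Lemma natr_powR_le (m : nat) (s t : R) : t < s ->
  m%:R * (2 ^- m) `^ s <= ((s - t) * ln 2)^-1 * (2 ^- m) `^ t.
Proof.
move=> ts; have l2 : 0 < ln 2 :> R by rewrite ln_gt0// ltr1n.
have st : 0 < s - t by rewrite subr_gt0.
rewrite mulrC ler_pdivlMl ?mulr_gt0//.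
have -> : (2 ^- m) `^ t = (2 ^- m) `^ s * expR (m%:R * ((s - t) * ln 2)).
  rewrite !powR_halfX /powR (negbTE (lt0r_neq0 _))// -expRD; congr expR; ring.
rewrite mulrCA ler_pM2l ?powR_gt0 ?invr_gt0 ?exprn_gt0//.
by apply: le_trans (expR_ge1Dx _); rewrite mulrC lerDr.
Qed.

End strip_family.

Section almost_sure.
Context {R : realType} (M N : nat -> nat).
Hypothesis hM : forall n, (2 <= M n)%N.
Hypothesis hN0 : forall n, (0 < N n)%N.
Context (d : measure_display) (Omega : measurableType d)
  (P : probability Omega R)
  (X : forall n : nat, address N n.+1 -> Omega -> 'I_(M n) * 'I_(M n)).
Hypothesis hX : random_choices P X.
Context (C0 s1 t : R).
Hypotheses (t_ge0 : 0 <= t) (ts1 : t < s1) (s1_lt1 : s1 < 1).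
Hypothesis hP : forall k,
  (#|address N k|%:R)^-1 <= C0 * scale (R := R) M k `^ s1.

(** Level [m] is the first rank whose side length is at most [2 ^- m].  The
    [2 * (8 * 2 ^ m) ^ 2 = 128 * 4 ^ m] strips of scale [m] have exceptional
    probabilities of order [8 ^- m], so that the sum over the strips and over
    [m] converges.  The finitely many remaining scales only change the
    constant. *)
Lemma ae_strip_count : exists level : nat -> nat,
  (forall m, scale (R := R) M (level m) <= 2 ^- m) /\
  {ae P, forall w, exists K : R, forall m (S : strip_index m),
     #|strip_hits (R := R) (sample X w) (n := level m) S|%:R <=
     K * (2 ^- m) `^ t * #|address N (level m)|%:R}.
Proof.
have s1_gt0 : 0 < s1 by exact: le_lt_trans ts1.
have h2 m : 0 < 2 ^- m :> R by rewrite invr_gt0 exprn_gt0.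
have h21 m : 2 ^- m <= 1 :> R by rewrite invf_le1 ?exprn_gt0// exprn_ege1// ler1n.
pose level m := ex_minn (scale_small (R := R) hM (h2 m)).
have level_le m : scale (R := R) M (level m) <= 2 ^- m.
  by rewrite /level; case: ex_minnP.
have level_gt m k : (k < level m)%N -> 2 ^- m < scale (R := R) M k.
  rewrite /level; case: ex_minnP => n _ hn kn; rewrite ltNge.
  by apply: contraL kn => /hn; rewrite leqNgt.
exists level; split=> //.
pose D := sum_cst C0 s1.
pose bad m (S : strip_index m) := [set f : config M N (level m) |
  56 * D * m%:R * (2 ^- m) `^ s1 * #|address N (level m)|%:R <
  (strip_count (2 ^- m : R) (strip_form S).1 (strip_form S).2 (strip_center S) f)%:R
  ]%SET.
pose Bad m := (\bigcup_(S : strip_index m) bad m S)%SET.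
pose E m := [set w | config_of (sample X w) (level m) \in Bad m].
have mE m : measurable (E m) by exact: (probability_config hM hX _).1.
have PE m : (P (E m) <= ((128 * expR 3) * 2 ^- m)%:E)%E.
  apply: le_trans (probability_config hM hX _).2 _; rewrite lee_fin.
  apply: (@le_trans _ _ (config_weight M N (level m) *
      \sum_(S : strip_index m) #|bad m S|%:R)).
    rewrite ler_wpM2l ?config_weight_ge0// -natr_sum ler_nat /Bad.
    elim/big_rec2: _ => [|S u v _ h]; first by rewrite cards0.
    by apply: leq_trans (leq_card_setU _ _) _; rewrite leq_add2l.
  rewrite mulr_sumr.
  apply: (@le_trans _ _ (\sum_(S : strip_index m) expR 3 * 8 ^- m)).
    apply: ler_sum => S _.
    apply: (strip_count_tail hM hN0 s1_gt0 s1_lt1 hP _ (h21 m)) => //.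
    - exact: level_gt.
    - by rewrite /strip_form; case: ifP; [right|left].
  rewrite sumr_const !card_prod card_bool !card_ord -[leLHS]mulr_natr !natrM !natrX.
  have -> : 8 = 2 ^+ 3 :> R by ring.
  rewrite -exprM mulnC exprM le_eqVlt; apply/orP; left; apply/eqP.
  by field; rewrite expf_neq0.
have C1 : 0 <= 128 * expR 3 :> R by rewrite mulr_ge0// expR_ge0.
have := ae_eventually_not C1 mE PE; apply: filterS => w [m0 hm0].
pose K1 := 56 * D * ((s1 - t) * ln 2)^-1.
have D1 : 1 <= D by exact: (sum_cst_ge1 s1_lt1 hP).
have K10 : 0 <= K1.
  rewrite mulr_ge0//; first by rewrite mulr_ge0// (le_trans _ D1).
  by rewrite invr_ge0 mulr_ge0// ?subr_ge0 ?ltW// ln_gt0// ltr1n.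
exists (K1 + 2 `^ (m0%:R * t)) => m S.
have hitsE : #|strip_hits (R := R) (sample X w) (n := level m) S| =
   strip_count (2 ^- m : R) (strip_form S).1 (strip_form S).2 (strip_center S)
     (config_of (sample X w) (level m)).
  by apply: eq_card => j; rewrite !inE /= cantor_square_config.
have [mm0|mm0] := leqP m0 m.
  have := hm0 m mm0; rewrite /E /= => /negP hb.
  have {hb}: config_of (sample X w) (level m) \notin bad m S.
    by apply: contra hb => hb; apply/bigcupP; exists S.
  rewrite inE -leNgt hitsE => /le_trans; apply; rewrite ler_wpM2r//.
  apply: (@le_trans _ _ (K1 * (2 ^- m) `^ t)).
    rewrite -mulrA /K1 -[leRHS]mulrA ler_wpM2l ?natr_powR_le//.
    by rewrite mulr_ge0// (le_trans _ D1).
  by rewrite ler_wpM2r ?powR_ge0// lerDl powR_ge0.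
rewrite -[leLHS]mul1r; apply: ler_pM => //; last by rewrite ler_nat max_card.
rewrite powR_halfX powRN ler_pdivlMr ?powR_gt0// mul1r.
apply: (@le_trans _ _ (2 `^ (m0%:R * t))); last by rewrite lerDr.
by rewrite ler_powR ?ler1n// ler_wpM2r// ler_nat ltnW.
Qed.

End almost_sure.

(** * Infinite branches avoiding sparse sets of squares *)

Section branches.
Context {R : realType} (N : nat -> nat).
Hypothesis hN0 : forall n, (0 < N n)%N.

Let P_gt0 k : 0 < #|address N k|%:R :> R.
Proof. by rewrite ltr0n card_address prodn_gt0. Qed.

Section avoid.
Variable hit : forall n, pred (address N n).

Fixpoint killed n : pred (address N n) :=
  match n return pred (address N n) with
  | 0 => hit (n := 0)
  | m.+1 => fun j : address N m.+1 => killed (n := m) j.1 || hit j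
  end.

Lemma killed_density n :
  #|killed (n := n)|%:R / #|address N n|%:R <=
  \sum_(k < n.+1) #|hit (n := k)|%:R / #|address N k|%:R :> R.
Proof.
elim: n => [|n IH]; first by rewrite big_ord1.
rewrite big_ord_recr /=; set T := _ / _ in IH; set U := \sum_(_ < _) _ in IH *.
apply: (@le_trans _ _ ((#|[pred j : address N n.+1 | killed (n := n) j.1]|%:R +
     #|hit (n := n.+1)|%:R) / #|address N n.+1|%:R)).
  rewrite ler_pM2r ?invr_gt0 ?(P_gt0 n.+1)// -natrD ler_nat.
  rewrite -cardUI; apply: leq_trans (leq_addr _ _).
  by apply: subset_leq_card; apply/fintype.subsetP => j; rewrite !inE.
rewrite mulrDl lerD2r; apply: le_trans IH.
have -> : #|[pred j : address N n.+1 | killed (n := n) j.1]| =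
    (#|killed (n := n)| * N n)%N.
  rewrite -[N n in RHS]card_ord -cardX; apply: eq_card => -[j i].
  by rewrite !inE /= andbT.
rewrite card_prod card_ord !natrM -mulf_div divff ?mulr1//.
by rewrite pnatr_eq0 -lt0n.
Qed.

(** [j] has a descendant [k] generations later that is not killed.  Going down
    one generation at a time avoids transporting addresses between equal ranks. *)
Fixpoint alive k n (j : address N n) : Prop :=
  if k is k'.+1 then exists i : 'I_(N n), alive k' (n := n.+1) (j, i)
  else ~~ killed j.

Lemma aliveW l n (j : address N n) : alive l j -> ~~ killed j.
Proof.
elim: l n j => [|l IH] n j //= [i /IH]; apply: contra => kj.
by rewrite /= kj.
Qed.

Lemma alive_anti k l n (j : address N n) : (k <= l)%N -> alive l j -> alive k j.
Proof.
elim: k l n j => [|k IH] [|l] n j //=; last first.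
  by move=> kl [i ai]; exists i; apply: IH ai.
by move=> _; exact: (@aliveW l.+1).
Qed.

(** Koenig's lemma: if each of the finitely many children died after some
    number of generations, the parent would die after the largest of them. *)
Lemma alive_child n (j : address N n) :
  (forall k, alive k j) -> exists i : 'I_(N n), forall k, alive k (n := n.+1) (j, i).
Proof.
move=> aj; apply: contrapT => /forallNP no.
have /choice[K hK] : forall i : 'I_(N n), exists k, ~ alive k (n := n.+1) (j, i).
  by move=> i; apply/existsNP; exact: no.
have [i ai] := aj (\max_i K i).+1.
by apply: (hK i); apply: alive_anti ai; exact: leq_bigmax.
Qed.

Hypothesis sparse : forall n,
  \sum_(k < n) #|hit (n := k)|%:R / #|address N k|%:R < 1 :> R.

Lemma alive_somewhere k n : exists j : address N n, alive k j.
Proof.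
elim: k n => [|k IH] n /=; last first.
  by have [[j i] aj] := IH n.+1; exists j, i.
apply: contrapT => /forallNP no.
have := le_lt_trans (killed_density n) (sparse n.+1).
rewrite ltNge (_ : #|killed (n := n)| = #|address N n|).
  by rewrite divff ?lexx// lt0r_neq0.
by apply: eq_card => j; rewrite !inE; apply/negPn/negP/no.
Qed.

Lemma avoiding_branch : exists b : forall n, address N n,
  (forall n, (b n.+1).1 = b n) /\ forall n, ~~ hit (b n).
Proof.
pose node n := {j : address N n | forall k, alive k j}.
have root : node 0.
  by exists tt => k; have [[]] := alive_somewhere k 0.
pose next n (j : node n) : node n.+1 :=
  let e := cid (alive_child (proj2_sig j)) in
  exist _ (proj1_sig j, proj1_sig e) (proj2_sig e).
pose b := fix b n : node n := if n is m.+1 then next m (b m) else root.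
exists (fun n => proj1_sig (b n)); split => // n.
have /(_ 0) := proj2_sig (b n); apply: contra.
by case: n {root b} (proj1_sig _) => //= n j ->; rewrite orbT.
Qed.

End avoid.

(** Infinitely many obstacles [i], each one active at the single rank [L i].
    Several of them may share a rank, but at a given rank only finitely many
    matter as there are finitely many addresses. *)
Lemma avoiding_branch_family (H : nat -> forall n, pred (address N n))
    (L : nat -> nat) (a : nat -> R) (q : R) : q < 1 ->
  (forall i, #|H i (L i)|%:R <= a i * #|address N (L i)|%:R) ->
  (forall I, \sum_(i < I) a i <= q) ->
  exists b : forall n, address N n,
    (forall n, (b n.+1).1 = b n) /\ forall i, ~~ H i (L i) (b (L i)).
Proof.
move=> q1 Ha aq.
pose hit n : pred (address N n) := fun j => `[< exists2 i, L i = n & H i n j >].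
have a0 i : 0 <= a i.
  by have := Ha i; rewrite -ler_pdivrMr//; apply: le_trans; rewrite divr_ge0.
have [b [b1 b2]] : exists b : forall n, address N n,
    (forall n, (b n.+1).1 = b n) /\ forall n, ~~ hit n (b n).
  apply: avoiding_branch => n; apply: le_lt_trans q1.
  have [f hf] : exists f : forall k, address N k -> nat, forall k j, hit k j ->
      L (f k j) = k /\ H (f k j) k j.
    have /choice[f hf] : forall x : {k & address N k}, exists i,
        hit (tag x) (tagged x) -> L i = tag x /\ H i (tag x) (tagged x).
      move=> [k j] /=; have [hk|hk] := boolP (hit k j); last by exists 0%N.
      by move/asboolP : (hk) => [i Li Hi]; exists i.
    by exists (fun k j => f (existT _ k j)) => k j hj; have := hf (existT _ k j) hj.
  (* A number of obstacles sufficient to explain all hits below rank n. *)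
  pose I := (\max_(k < n) \max_(j : address N k) f k j).+1.
  apply: le_trans (aq I).
  apply: (@le_trans _ _ (\sum_(k < n) \sum_(i < I | L i == k) a i)).
    apply: ler_sum => k _; rewrite ler_pdivrMr// mulr_suml.
    apply: (@le_trans _ _ (\sum_(i < I | L i == k) #|H i k|%:R)); last first.
      by apply: ler_sum => i /eqP Li; have := Ha i; rewrite Li.
    rewrite -natr_sum ler_nat -sum1_card.
    apply: (@leq_trans (\sum_(j in hit k) \sum_(i < I | (L i == k) && H i k j) 1)).
      apply: leq_sum => j hj; have [Lf Hf] := hf k j hj.
      have fI : (f k j < I)%N.
        rewrite ltnS (leq_trans _ (leq_bigmax k))//=; exact: leq_bigmax.
      by rewrite (bigD1 (Ordinal fI))//= Lf eqxx.
    rewrite (exchange_big_dep (fun i : 'I_I => L i == k))/=;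
      last by move=> ? ? _ /andP[].
    apply: leq_sum => i Li; rewrite -sum1_card.
    rewrite [leqRHS]big_mkcond [leqLHS]big_mkcond; apply: leq_sum => j _.
    rewrite Li /=; case: ifP => // /andP[_ Hj]; case: ifP => //.
    by rewrite /in_mem/= Hj.
  rewrite (exchange_big_dep xpredT)//=; apply: ler_sum => i _.
  rewrite sumr_const; have [Ln|Ln] := ltnP (L i) n.
    rewrite (_ : #|_| = 1%N) ?mulr1n// -(card1 (Ordinal Ln)).
    by apply: eq_card => k; rewrite !inE -val_eqE eq_sym.
  rewrite (_ : #|_| = 0%N) ?mulr0n// -(card0 'I_n).
  apply: eq_card => k; rewrite !inE; apply/negbTE; apply: contraTneq Ln => ->.
  by rewrite -ltnNge.
exists b; split=> // i; apply: contra (b2 (L i)) => Hi.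
by apply/asboolP; exists i.
Qed.

End branches.

Section branch_points.
Context {R : realType} (M N : nat -> nat).
Hypothesis hM : forall n, (2 <= M n)%N.

Lemma nested_intervals (u v : nat -> R) : (forall n, u n <= u n.+1) ->
  (forall n, v n.+1 <= v n) -> (forall n, u n <= v n) ->
  exists x, forall n, u n <= x <= v n.
Proof.
move=> ui vd uv.
have uim m n : (m <= n)%N -> u m <= u n by move: m n; apply/nondecreasing_seqP.
have vdm m n : (m <= n)%N -> v n <= v m by move: m n; apply/nonincreasing_seqP.
have uvm m n : u m <= v n.
  by apply: le_trans (uim _ _ (leq_maxl m n)) (le_trans (uv _) (vdm _ _ (leq_maxr m n))).
exists (sup (range u)) => n; apply/andP; split.
  apply: ub_le_sup; last by exists n.
  by exists (v 0%N) => _ [m _ <-].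
apply: ge_sup; first by exists (u 0%N), 0%N.
by move=> _ [m _ <-].
Qed.

Lemma branch_point (c : choices M N) (b : forall n, address N n) :
  (forall n, (b n.+1).1 = b n) ->
  exists x : R * R, forall n, square_set (cantor_square c (b n)) x.
Proof.
move=> hb; pose Q n := cantor_square (R := R) c (b n).
have step n := cantor_square_child (R := R) hM c (b n.+1).
have s0 n : 0 < scale (R := R) M n by exact: scale_gt0.
have [||n|x1 hx1] := @nested_intervals (fun n => sq_x (Q n))
  (fun n => sq_x (Q n) + scale M n).
- by move=> n; have := step n; rewrite /= hb => -[[]].
- by move=> n; have := step n; rewrite /= hb => -[[]].
- by rewrite lerDl ltW.
have [||n|x2 hx2] := @nested_intervals (fun n => sq_y (Q n))
  (fun n => sq_y (Q n) + scale M n).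
- by move=> n; have := step n; rewrite /= hb => -[_ []].
- by move=> n; have := step n; rewrite /= hb => -[_ []].
- by rewrite lerDl ltW.
exists (x1, x2) => n; rewrite /square_set /= cantor_square_side.
by split => /=; rewrite in_itv/=; [exact: hx1|exact: hx2].
Qed.

End branch_points.

(** * Projections and strips *)

Section geometry.
Context {R : realType}.
Implicit Types p u x y : R * R.

Lemma dotp_self_gt0 u : u != 0 -> 0 < dotp u u.
Proof.
move=> u0; rewrite lt_neqAle /dotp -!expr2 addr_ge0 ?sqr_ge0// andbT eq_sym.
apply: contra u0; rewrite paddr_eq0 ?sqr_ge0// !sqrf_eq0.
by case: u => a b /= /andP[/eqP -> /eqP ->].
Qed.

Lemma euclid_dist_line_proj p u x y : u != 0 ->
  euclid_dist (line_proj p u x) (line_proj p u y) ^+ 2 * dotp u u =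
  dotp (x.1 - y.1, x.2 - y.2) u ^+ 2.
Proof.
move=> /dotp_self_gt0/lt0r_neq0 u0.
rewrite /euclid_dist sqr_sqrtr ?addr_ge0 ?sqr_ge0//.
by move: u0; rewrite /line_proj /dotp /= => u0; field.
Qed.

(** Coefficients of a linear form that has a coefficient equal to 1: such a form
    is controlled by counting along one coordinate axis. *)
Definition unit_form (o : bool) (a : R) : R * R := if o then (a, 1) else (1, a).

(** Divide the direction by its largest coordinate: this coordinate is at least
    [1 / Num.sqrt 2] times the length, so distances grow by at most 2. *)
Lemma strip_of_projection u : u != 0 -> exists (o : bool) (a : R), `|a| <= 1 /\
  forall p x y e,
    euclid_dist (line_proj p u x) (line_proj p u y) <= e ->
    `|dotp x (unit_form o a) - dotp y (unit_form o a)| <= 2 * e.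
Proof.
move=> u0; have uu := dotp_self_gt0 u0.
have key (k a b : R) : k != 0 -> dotp u u = k ^+ 2 * (1 + a ^+ 2) ->
    `|a| <= 1 -> forall p x y e z, euclid_dist (line_proj p u x) (line_proj p u y) <= e ->
    dotp (x.1 - y.1, x.2 - y.2) u = k * z -> `|z| <= 2 * e.
  move=> k0 uuE a1 p x y e z de dE.
  have := euclid_dist_line_proj p x y u0; rewrite dE uuE exprMn.
  have d0 : 0 <= euclid_dist (line_proj p u x) (line_proj p u y) by exact: sqrtr_ge0.
  move: (euclid_dist _ _) d0 de => D D0 De H.
  have e0 : 0 <= e by exact: le_trans De.
  have {}H : z ^+ 2 = D ^+ 2 * (1 + a ^+ 2).
    apply: (mulfI (expf_neq0 2 k0)); rewrite -H; ring.
  have a2 : a ^+ 2 <= 1 by rewrite -real_normK ?num_real// expr_le1.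
  have D2 : D ^+ 2 <= e ^+ 2 by rewrite ler_sqr.
  rewrite -ler_sqr ?nnegrE ?mulr_ge0// real_normK ?num_real// H.
  by have := sqr_ge0 D; nra.
have main (k l : R) : (u = (l, k) \/ u = (k, l)) -> `|l| <= `|k| ->
    k != 0 /\ `|l / k| <= 1.
  move=> uE lk; have k0 : k != 0.
    apply: contraTneq lk => k0; rewrite k0 normr0 -ltNge normr_gt0.
    apply: contra u0 => /eqP l0; apply/eqP.
    by case: uE => ->; rewrite k0 l0.
  by split=> //; rewrite normrM normfV ler_pdivrMr ?normr_gt0// mul1r.
have [h|h] := leP `|u.1| `|u.2|.
  have [k0 a1] := main u.2 u.1 (or_introl (surjective_pairing u)) h.
  exists true, (u.1 / u.2); split=> // p x y e de.
  apply: (key u.2 (u.1 / u.2) 0 _ _ a1 p x y) => //; rewrite /dotp /=.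
    by field.
  by field.
have [k0 a1] := main u.1 u.2 (or_intror (surjective_pairing u)) (ltW h).
exists false, (u.2 / u.1); split=> // p x y e de.
apply: (key u.1 (u.2 / u.1) 0 _ _ a1 p x y) => //; rewrite /dotp /=.
  by field.
by field.
Qed.

Lemma grid_point_near (m : nat) (z : R) : -2 <= z -> z <= 2 ->
  exists i : 'I_(8 * 2 ^ m), `|z - grid_point m i| <= 2 ^- m.
Proof.
move=> z1 z2; have p0 : 0 < 2 ^+ m :> R by rewrite exprn_gt0.
have y0 : 0 <= (z + 4) * 2 ^+ m by rewrite mulr_ge0 ?ltW//; lra.
have /andP[h1 h2] := truncn_itv y0.
have hi : (Num.truncn ((z + 4) * 2 ^+ m) < 8 * 2 ^ m)%N.
  by rewrite truncn_lt_nat// natrM natrX ltr_pM2r//; lra.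
exists (Ordinal hi); rewrite /grid_point /=.
move: h1 h2; move: (Num.truncn _) => i; rewrite -(natr1 i) => h1 h2.
have E : (z - (i%:R * 2 ^- m - 4)) * 2 ^+ m = (z + 4) * 2 ^+ m - i%:R.
  by field; exact: lt0r_neq0.
rewrite -(ler_pM2r p0) mulVf ?lt0r_neq0// -[X in _ * X <= _](gtr0_norm p0) -normrM E.
by rewrite ler_norml; apply/andP; split; lra.
Qed.

(** A square of side at most [w = 2 ^- m] that meets a strip of half-width [w]
    has its corner in a discretized strip of half-width [5 * w]: one [w] for
    each of the coefficient, the two coordinates, the strip itself and the
    center. *)
Lemma discretize_strip (m : nat) o (a z : R) : `|a| <= 1 -> -2 <= z -> z <= 2 ->
  exists S : strip_index m, forall (Q : square R) x,
    0 <= sq_x Q <= 1 -> 0 <= sq_y Q <= 1 -> sq_side Q <= 2 ^- m ->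
    square_set Q x -> `|dotp x (unit_form o a) - z| <= 2 ^- m ->
    `|corner (strip_form S).1 (strip_form S).2 Q - strip_center S| <= 5 * 2 ^- m.
Proof.
move=> a1 z1 z2; have /andP[a2 a3] : -1 <= a <= 1 by rewrite -ler_norml.
have [||i hi] := @grid_point_near m a; [lra|lra|].
have [k hk] := grid_point_near m z1 z2.
exists (o, (i, k)) => Q x /andP[X0 X1] /andP[Y0 Y1] side.
rewrite /square_set /= !in_itv/= => -[/andP[x1 x2] /andP[y1 y2]] hz.
have W0 : 0 <= 2 ^- m :> R by rewrite invr_ge0 exprn_ge0.
rewrite /strip_form /strip_center /corner /=.
move: (grid_point m i) (grid_point m k) hi hk => g h hi hk.
move: (2 ^- m) W0 side hz hi hk => W W0 side hz hi hk.
have small (b s t : R) : `|b| <= 1 -> `|s| <= t -> `|b * s| <= t.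
  by move=> b1 st; rewrite normrM -[t]mul1r ler_pM.
have dx : `|sq_x Q - x.1| <= W by rewrite ler_norml; apply/andP; split; lra.
have dy : `|sq_y Q - x.2| <= W by rewrite ler_norml; apply/andP; split; lra.
have sX : `|sq_x Q| <= 1 by rewrite ger0_norm.
have sY : `|sq_y Q| <= 1 by rewrite ger0_norm.
have five (t1 t2 t3 t4 t5 : R) : `|t1| <= W -> `|t2| <= W -> `|t3| <= W ->
    `|t4| <= W -> `|t5| <= W -> `|t1 + t2 + t3 + t4 + t5| <= 5 * W.
  move=> /ler_normlP[? ?] /ler_normlP[? ?] /ler_normlP[? ?].
  move=> /ler_normlP[? ?] /ler_normlP[? ?].
  by apply/ler_normlP; split; lra.
rewrite distrC in hi; case: o hz => /= hz.
  have -> : g * sq_x Q + 1 * sq_y Q - h = sq_x Q * (g - a) + a * (sq_x Q - x.1) +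
     (sq_y Q - x.2) + (dotp x (a, 1) - z) + (z - h) by rewrite /dotp/=; ring.
  by apply: five => //; exact: small.
have -> : 1 * sq_x Q + g * sq_y Q - h = sq_y Q * (g - a) + a * (sq_y Q - x.2) +
   (sq_x Q - x.1) + (dotp x (1, a) - z) + (z - h) by rewrite /dotp/=; ring.
by apply: five => //; exact: small.
Qed.

(** The error [eta] is there for sets of diameter 0, to which no dyadic scale is
    comparable. *)
Lemma choose_dyadic (t e eta : R) : 0 <= t -> 0 <= e -> e <= 4^-1 -> 0 < eta ->
  exists m : nat, 2 * e <= 2 ^- m /\ (2 ^- m) `^ t <= 4 `^ t * e `^ t + eta.
Proof.
move=> t0 e0 e4 eta0; have [->|ne0] := eqVneq e 0.
  have [->|tn0] := eqVneq t 0.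
    by exists 0%N; rewrite !powRr0 mulr0 mulr1 invr_ge0 exprn_ge0// lerDl ltW.
  have tp : 0 < t by rewrite lt0r tn0.
  have l2 : 0 < ln 2 :> R by rewrite ln_gt0// ltr1n.
  pose C := ((t - 0) * ln 2)^-1; have C0 : 0 < C by rewrite invr_gt0 subr0 mulr_gt0.
  pose m := (Num.bound (C / eta)).+1; exists m; split.
    by rewrite mulr0 invr_ge0 exprn_ge0.
  apply: (@le_trans _ _ eta); last by rewrite lerDr mulr_ge0 ?powR_ge0.
  have m0 : 0 < m%:R :> R by rewrite ltr0n.
  have := natr_powR_le m tp; rewrite -/C powRr0 mulr1 => h.
  rewrite -(ler_pM2l m0); apply: le_trans h _.
  rewrite -ler_pdivrMr//; apply/ltW/(lt_le_trans (archi_boundP _)).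
    by rewrite divr_ge0// ltW.
  by rewrite ler_nat leqnSn.
have ep : 0 < e by rewrite lt0r ne0.
have ex : exists n, 2 ^- n.+1 <= 2 * e.
  have [n hn] := half_expn_small (mulr_gt0 (ltr0n R 2) ep : 0 < 2 * e).
  exists n; apply: le_trans hn; rewrite lef_pV2 ?posrE ?exprn_gt0//.
  by rewrite exprS ler_peMl ?exprn_ge0// ler1n.
have [m hm mmin] := ex_minnP ex; exists m; split.
  case: m hm mmin => [|m] hm mmin; first by rewrite expr0 invr1; lra.
  by rewrite leNgt; apply/negP => /ltW/mmin; rewrite ltnn.
have E4 : (2 ^- m : R) <= 4 * e.
  by move: hm; rewrite exprS invfM; lra.
rewrite -powRM//; apply: (@le_trans _ _ ((4 * e) `^ t)); last by rewrite lerDl ltW.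
by apply: ge0_ler_powR => //; rewrite nnegrE ?mulr_ge0// invr_ge0 exprn_ge0.
Qed.

End geometry.

(** * The lower bound: mass distribution along branches *)

Section gauge.
Context {R : realType}.
Implicit Types (U : set (R * R)).

Lemma hausdorff_gauge_ge0 (t : R) U : (0 <= hausdorff_gauge t U)%E.
Proof. by rewrite /hausdorff_gauge; case: ifP => // _; exact: poweR_ge0. Qed.

Lemma euclid_dist_diameter U x y : U x -> U y ->
  ((euclid_dist x y)%:E <= diameter U)%E.
Proof.
move=> Ux Uy; rewrite /diameter; case: eqP => [U0|_].
  by move: Ux; rewrite U0.
by apply: ereal_sup_ubound; exists (x, y).
Qed.

Lemma euclid_dist_ge0 (x y : R * R) : 0 <= euclid_dist x y.
Proof. exact: sqrtr_ge0. Qed.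

End gauge.

Section lower.
Context {R : realType} (M N : nat -> nat).
Hypothesis hM : forall n, (2 <= M n)%N.
Hypothesis hN0 : forall n, (0 < N n)%N.

Lemma cantor_set_unit (c : choices M N) (x : R * R) : cantor_set c x ->
  (0 <= x.1 <= 1) /\ (0 <= x.2 <= 1).
Proof.
move=> /(_ 0%N Logic.I)[j _]; have := cantor_square_unit (R := R) hM c j.
have sE := cantor_square_side (R := R) c j.
move: (cantor_square c j) sE => Q sE.
rewrite /square_set /= !in_itv/= sE => -[[? ?] [? ?]].
move=> [/andP[? ?] /andP[? ?]]; split; apply/andP; split; lra.
Qed.

(** Otherwise take a cover by sets of diameter at most 1/4 with a very small
    sum of [t]-th powers, and a strip for each set of the cover that meets the
    projection.  The strips meet at most half of the squares of any rank, which
    leaves a branch whose point projects outside of the cover. *)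
Lemma hausdorff_measure_proj_neq0 (c : choices M N) (level : nat -> nat)
    (K t : R) (p u : R * R) :
  0 <= t -> u != 0 -> (forall m, scale (R := R) M (level m) <= 2 ^- m) ->
  (forall m (S : strip_index m),
     #|strip_hits (R := R) c (n := level m) S|%:R <=
     K * (2 ^- m) `^ t * #|address N (level m)|%:R) ->
  hausdorff_measure t (line_proj p u @` cantor_set c) <> 0%E.
Proof.
move=> t0 u0 hlevel hK H0.
pose K1 : R := `|K| + 1; have K10 : 0 < K1 by rewrite /K1 ltr_wpDl.
have P4 : 0 < 4 `^ t by exact: powR_gt0.
pose eta : R := (4 * K1)^-1; have eta0 : 0 < eta by rewrite invr_gt0 mulr_gt0.
pose eps : R := (4 * K1 * 4 `^ t)^-1.
have eps0 : 0 < eps by rewrite invr_gt0 mulr_gt0// mulr_gt0.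
set F := cantor_set c in H0; set A := line_proj p u @` F in H0.
have [_ [U [AU Ud] <-] Ueps] : exists2 y,
    [set (\sum_(0 <= i <oo) hausdorff_gauge t (U i))%E | U in
    [set U : nat -> set (R * R) |
      A `<=` \bigcup_i U i /\ forall i, (diameter (U i) <= (4^-1)%:E)%E]] y &
    (y < eps%:E)%E.
  apply: ereal_inf_lt; apply: (@le_lt_trans _ _ 0%E); last by rewrite lte_fin.
  by rewrite -[leRHS]H0; apply: ereal_sup_ubound; exists 4^-1; [rewrite /= invr_gt0|].
have [ori [a [a1 proj]]] := strip_of_projection u0.
(* For each set of the cover: an obstacle, its rank, its density and a lower
   bound of the gauge. *)
have data i : exists r : (forall n, pred (address N n)) * nat * R * R,
    [/\ #|r.1.1.1 r.1.1.2|%:R <= r.1.2 * #|address N r.1.1.2|%:R,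
        (forall x (j : address N r.1.1.2), F x -> U i (line_proj p u x) ->
           square_set (cantor_square c j) x -> r.1.1.1 _ j),
        (r.2%:E <= hausdorff_gauge t (U i))%E &
        r.1.2 <= K1 * (4 `^ t * r.2 + eta / 2 ^+ i.+1)].
  have etai : 0 < eta / 2 ^+ i.+1 by rewrite divr_gt0// exprn_gt0.
  have [[x [Fx Ux]]|no] := pselect (exists x, F x /\ U i (line_proj p u x)); last first.
    exists (fun n => pred0 : pred (address N n), 0%N, 0, 0); split => /=.
    - by rewrite card0 mul0r.
    - by move=> x j Fx Ux; exfalso; apply: no; exists x.
    - exact: hausdorff_gauge_ge0.
    - by rewrite mulr0 add0r mulr_ge0// ltW.
  have dge0 : (0 <= diameter (U i))%E.
    apply: le_trans (euclid_dist_diameter Ux Ux).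
    by rewrite lee_fin euclid_dist_ge0.
  have [e dE] : exists e, diameter (U i) = e%:E.
    exists (fine (diameter (U i))); rewrite fineK// ge0_fin_numE//.
    by apply: le_lt_trans (Ud i) _; rewrite ltry.
  have e0 : 0 <= e by rewrite -lee_fin -dE.
  have e4 : e <= 4^-1 by rewrite -lee_fin -dE.
  have [m [em tm]] := choose_dyadic t0 e0 e4 etai.
  pose z := dotp x (unit_form ori a).
  have /andP[al ar] : -1 <= a <= 1 by rewrite -ler_norml.
  have [/andP[? ?] /andP[? ?]] := cantor_set_unit Fx.
  have [||S hS] := @discretize_strip R m ori a z a1.
  - by rewrite /z /unit_form /dotp; case: (ori) => /=; nra.
  - by rewrite /z /unit_form /dotp; case: (ori) => /=; nra.
  exists (fun n => strip_hits (R := R) c (n := n) S : pred (address N n), level m,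
    K1 * (2 ^- m) `^ t, e `^ t).
  split => /=.
  - apply: le_trans (hK m S) _; rewrite ler_wpM2r// ler_wpM2r ?powR_ge0//.
    by rewrite /K1 (le_trans (ler_norm K))// lerDl.
  - move=> y j Fy Uy Qy; apply: hS Qy _.
    + have [[X0 X1] [Y0 Y1]] := cantor_square_unit (R := R) hM c j.
      by rewrite X0/=; have := scale_gt0 (R := R) hM (level m); lra.
    + have [[X0 X1] [Y0 Y1]] := cantor_square_unit (R := R) hM c j.
      by rewrite Y0/=; have := scale_gt0 (R := R) hM (level m); lra.
    + by rewrite cantor_square_side.
    + apply: le_trans em; apply: (proj p).
      by rewrite -lee_fin -dE; exact: euclid_dist_diameter.
  - rewrite /hausdorff_gauge; case: eqP => [U0|_]; first by move: Ux; rewrite U0.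
    by rewrite dE poweR_EFin.
  - by rewrite ler_pM2l.
have [r hr] := choice data.
have := @avoiding_branch_family R N hN0 (fun i => (r i).1.1.1)
  (fun i => (r i).1.1.2)
  (fun i => (r i).1.2) 2^-1.
case.
- by rewrite invf_lt1// ltr1n.
- by move=> i; have [] := hr i.
- move=> I.
  have gsum : \sum_(i < I) (r i).2 <= eps.
    rewrite -lee_fin -sumEFin; apply: le_trans (ltW Ueps).
    apply: le_trans (nneseries_lim_ge I _); last first.
      by move=> n _ _; exact: hausdorff_gauge_ge0.
    rewrite big_mkord; apply: lee_sum => i _; by have [] := hr i.
  have esum : \sum_(i < I) eta / 2 ^+ i.+1 <= eta.
    under eq_bigr do rewrite exprS invfM mulrA -exprVn.
    rewrite -mulr_sumr.
    have h : \sum_(i < I) 2^-1 ^+ i <= (1 - 2^-1)^-1 :> R.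
      by apply: sum_geometric_le; rewrite ?invr_ge0// invf_lt1// ltr1n.
    have etaE : eta = eta / 2 * (1 - 2^-1)^-1.
      have -> : 1 - 2^-1 = 2^-1 :> R by lra.
      by rewrite invrK divfK.
    by rewrite [leRHS]etaE ler_wpM2l// divr_ge0// ltW.
  apply: (@le_trans _ _ (\sum_(i < I) K1 * (4 `^ t * (r i).2 + eta / 2 ^+ i.+1))).
    by apply: ler_sum => i _; have [] := hr i.
  rewrite -mulr_sumr big_split/= -mulr_sumr.
  apply: (@le_trans _ _ (K1 * (4 `^ t * eps + eta))).
    by rewrite ler_pM2l// lerD// ler_pM2l.
  rewrite /eps /eta le_eqVlt; apply/orP; left; apply/eqP.
  by field; rewrite !lt0r_neq0.
move=> b [b1 b2].
have [x hx] := branch_point (R := R) hM c b1.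
have Fx : F x by move=> n _; exists (b n.+1) => //; exact: hx.
have [i _ Ui] := AU (line_proj p u x) (ex_intro2 _ _ x Fx erefl).
have [_ hi _ _] := hr i.
by have := b2 i; rewrite (hi x (b (r i).1.1.2) Fx Ui (hx _)).
Qed.

Lemma hausdorff_dim_proj_ge (c : choices M N) (level : nat -> nat)
    (K t : R) (p u : R * R) :
  u != 0 -> (forall m, scale (R := R) M (level m) <= 2 ^- m) ->
  (forall m (S : strip_index m),
     #|strip_hits (R := R) c (n := level m) S|%:R <=
     K * (2 ^- m) `^ t * #|address N (level m)|%:R) ->
  (t%:E <= hausdorff_dim (line_proj p u @` cantor_set c))%E.
Proof.
move=> u0 hlevel hK; apply: le_ereal_inf_tmp => _ [t' [t'0 Ht'] <-].
rewrite lee_fin leNgt; apply/negP => tt'.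
apply: (@hausdorff_measure_proj_neq0 c level `|K| t' p u) Ht' => // m S.
apply: le_trans (hK m S) _; rewrite ler_wpM2r//.
apply: (@le_trans _ _ (`|K| * (2 ^- m) `^ t)).
  by rewrite ler_wpM2r ?powR_ge0// ler_norm.
rewrite ler_wpM2l//; apply: ger_powR; last exact: ltW.
by rewrite invr_gt0 exprn_gt0//= invf_le1 ?exprn_gt0// exprn_ege1// ler1n.
Qed.

End lower.

(** * The upper bound *)

Section hausdorff_facts.
Context {R : realType}.
Implicit Types (A U : set (R * R)) (t : R).

Lemma hausdorff_premeasure_ge0 t e A : (0 <= hausdorff_premeasure t e A)%E.
Proof.
apply: le_ereal_inf_tmp => _ [U _ <-].
by apply: nneseries_ge0 => i _ _; exact: hausdorff_gauge_ge0.
Qed.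

Lemma hausdorff_dim_ge0 A : (0 <= hausdorff_dim A)%E.
Proof. by apply: le_ereal_inf_tmp => _ [t [t0 _] <-]; rewrite lee_fin. Qed.

Lemma hausdorff_measure_eq0 t A :
  (forall e eps : R, 0 < e -> 0 < eps ->
    (hausdorff_premeasure t e A <= eps%:E)%E) -> hausdorff_measure t A = 0%E.
Proof.
move=> h; apply/eqP; rewrite eq_le; apply/andP; split.
  apply: ge_ereal_sup => _ [e /= e0 <-].
  by apply/lee_addgt0Pr => eps eps0; rewrite add0e; exact: h.
apply: le_trans (hausdorff_premeasure_ge0 t 1 A) _.
by apply: ereal_sup_ubound; exists 1 => //=.
Qed.

Lemma hausdorff_premeasure_finite_cover (T : finType) (V : T -> set (R * R))
    (t e r : R) A :
  0 <= t -> 0 <= r -> r <= e -> A `<=` \bigcup_j V j ->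
  (forall j, (diameter (V j) <= r%:E)%E) ->
  (hausdorff_premeasure t e A <= (#|T|%:R * r `^ t)%:E)%E.
Proof.
move=> t0 r0 re AV Vr.
pose U i := if insub i is Some k then V (enum_val (k : 'I_#|T|)) else set0.
have dge0 W : (0 <= diameter W)%E.
  rewrite /diameter; case: ifPn => // /set0P[x Wx].
  apply: (@le_trans _ _ (euclid_dist x x)%:E); last first.
    by apply: ereal_sup_ubound; exists (x, x).
  by rewrite lee_fin; exact: euclid_dist_ge0.
have d0 : diameter (@set0 (R * R)) = 0%E by rewrite /diameter eqxx.
have Ud i : (diameter (U i) <= r%:E)%E.
  by rewrite /U; case: insub => [k|//]; rewrite ?d0 ?lee_fin.
have Ug i : (hausdorff_gauge t (U i) <= (r `^ t)%:E)%E.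
  rewrite /hausdorff_gauge; case: ifP => _; first by rewrite lee_fin powR_ge0.
  rewrite -poweR_EFin; apply: gt0_ler_poweR => //.
  - by rewrite in_itv /= dge0 leey.
  - by rewrite in_itv /= leey lee_fin r0.
apply: (@le_trans _ _ (\sum_(0 <= i <oo) hausdorff_gauge t (U i))%E).
  apply: ereal_inf_lbound; exists U => //; split.
    move=> x /AV[j _ Vx]; exists (val (enum_rank j)) => //.
    by rewrite /U valK enum_rankK.
  by move=> i; apply: le_trans (Ud i) _; rewrite lee_fin.
rewrite (nneseries_split 0 #|T|); last by move=> k _; exact: hausdorff_gauge_ge0.
rewrite add0n [X in (_ + X)%E]eseries0 ?adde0.
  apply: (@le_trans _ _ (\sum_(0 <= k < #|T|) (r `^ t)%:E)%E).
    by apply: lee_sum.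
  by rewrite sumEFin big_const_nat subn0 iter_addr_0 mulr_natl.
move=> i iT _; rewrite /U insubF; last by apply/negbTE; rewrite -leqNgt.
by rewrite /hausdorff_gauge eqxx.
Qed.

Lemma diameter_line_proj_square (p u : R * R) (Q : square R) : u != 0 ->
  0 <= sq_side Q -> (diameter (line_proj p u @` square_set Q) <= (2 * sq_side Q)%:E)%E.
Proof.
move=> u0 r0; have uu := dotp_self_gt0 u0.
rewrite /diameter; case: ifP => _; first by rewrite lee_fin mulr_ge0.
apply: ge_ereal_sup => _ [[_ _] [[x Qx <-] [y Qy <-]] <-] /=.
rewrite lee_fin -ler_sqr ?nnegrE ?euclid_dist_ge0 ?mulr_ge0//.
rewrite -(ler_pM2r uu) euclid_dist_line_proj// /dotp/=.
move: Qx Qy; rewrite /square_set /= !in_itv/=.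
move=> [/andP[? ?] /andP[? ?]] [/andP[? ?] /andP[? ?]].
move: uu; rewrite /dotp.
have sq (v : R) : - sq_side Q <= v -> v <= sq_side Q -> v ^+ 2 <= sq_side Q ^+ 2.
  by move=> h1 h2; rewrite -real_normK ?num_real// ler_sqr ?nnegrE// ler_norml h1 h2.
have : (x.1 - y.1) ^+ 2 <= sq_side Q ^+ 2 by apply: sq; lra.
have : (x.2 - y.2) ^+ 2 <= sq_side Q ^+ 2 by apply: sq; lra.
clear sq; move: (x.1 - y.1) (x.2 - y.2) (sq_side Q) => a b r hb ha _.
have cs : (a * u.1 + b * u.2) ^+ 2 <= (a ^+ 2 + b ^+ 2) * (u.1 * u.1 + u.2 * u.2).
  by have := sqr_ge0 (a * u.2 - b * u.1); nra.
apply: le_trans cs _; apply: ler_wpM2r.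
  by rewrite addr_ge0// -expr2 sqr_ge0.
have := sqr_ge0 r; lra.
Qed.

End hausdorff_facts.

Section upper.
Context {R : realType} (M N : nat -> nat).
Hypothesis hM : forall n, (2 <= M n)%N.

Lemma hausdorff_dim_proj_le (c : choices M N) (p u : R * R) (t : R) :
  u != 0 -> 0 <= t ->
  (forall e, 0 < e -> exists n, scale M n.+1 <= e /\
     #|address N n.+1|%:R * scale M n.+1 `^ t <= e) ->
  (hausdorff_dim (line_proj p u @` cantor_set c) <= t%:E)%E.
Proof.
move=> u0 t0 h; apply: ereal_inf_lbound; exists t => //; split => //.
apply: hausdorff_measure_eq0 => e eps e0 eps0.
have p2 : 0 < 2 `^ t :> R by exact: powR_gt0.
have [|n [n1 n2]] := h (Num.min (e / 2) (eps / 2 `^ t)).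
  by rewrite lt_min !divr_gt0.
move: n1 n2; rewrite !le_min => /andP[n1 _] /andP[_ n2].
have s0 := scale_gt0 (R := R) hM n.+1.
apply: (@le_trans _ _ (#|address N n.+1|%:R * (2 * scale M n.+1) `^ t)%:E).
  apply: (@hausdorff_premeasure_finite_cover _ (address N n.+1)
    (fun j => line_proj p u @` square_set (cantor_square c j))) => //.
  - by rewrite mulr_ge0// ltW.
  - by rewrite mulrC -ler_pdivlMr.
  - by move=> _ [x Fx <-]; have [j _ Qx] := Fx n Logic.I; exists j => //; exists x.
  - move=> j; have := @diameter_line_proj_square R p u (cantor_square c j) u0.
    by rewrite cantor_square_side; apply; exact: ltW.
rewrite lee_fin powRM// ?(ltW s0)// mulrCA mulrC.
by rewrite -ler_pdivlMr.
Qed.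

End upper.

(** * Numbers of squares and side lengths *)

Section liminf.
Context {R : realType}.
Local Open Scope ereal_scope.
Implicit Types (v : (\bar R)^nat) (t : \bar R).

Lemma limn_einfE v : limn_einf v = ereal_sup (range (einfs v)).
Proof. by rewrite limn_einf_lim; apply/cvg_lim => //; exact: cvg_einfs_sup. Qed.

Lemma limn_einf_lt_infinitely_often v t : limn_einf v < t ->
  forall n, exists2 m, (n <= m)%N & v m < t.
Proof.
move=> h n; apply: contrapT => no; move: h; rewrite ltNge => /negP; apply.
rewrite limn_einfE; apply: (@le_trans _ _ (einfs v n)).
  apply: le_ereal_inf_tmp => _ [m /= nm <-]; rewrite leNgt; apply/negP => mt.
  by apply: no; exists m.
by apply: ereal_sup_ubound; exists n.
Qed.

Lemma lt_limn_einf_eventually v t : t < limn_einf v ->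
  exists n, forall m, (n <= m)%N -> t <= v m.
Proof.
rewrite limn_einfE => /ereal_sup_gt[_ [n _ <-] tn]; exists n => m nm.
by apply: le_trans (ltW tn) _; apply: ereal_inf_lbound; exists m.
Qed.

End liminf.

Section entropy.
Context {R : realType} (M N : nat -> nat).
Hypothesis hM : forall n, (2 <= M n)%N.
Hypothesis hN0 : forall n, (0 < N n)%N.

Definition entropy_ratio (n : nat) : R :=
  (\sum_(i < n.+1) ln (N i)%:R) / (\sum_(i < n.+1) ln (M i)%:R).

Let lnM n : R := \sum_(i < n) ln (M i)%:R.
Let lnN n : R := \sum_(i < n) ln (N i)%:R.

Let lnM_gt0 n : 0 < lnM n.+1.
Proof.
rewrite /lnM big_ord_recl ltr_pwDl//; first by rewrite ln_gt0// ltr1n.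
by apply: sumr_ge0 => i _; rewrite ln_ge0// ler1n ltnW.
Qed.

Let lnN_ge0 n : 0 <= lnN n.
Proof. by apply: sumr_ge0 => i _; rewrite ln_ge0// ler1n. Qed.

Lemma entropy_ratio_ge0 n : 0 <= entropy_ratio n.
Proof. by rewrite divr_ge0 ?lnN_ge0// ltW// lnM_gt0. Qed.

Let scale_expR n : scale M n = expR (- lnM n).
Proof.
rewrite expRN expR_sum; congr (_^-1); apply: eq_bigr => i _.
by rewrite lnK// posrE ltr0n ltnW.
Qed.

Let card_expR n : #|address N n|%:R = expR (lnN n).
Proof.
rewrite card_address natr_prod expR_sum; apply: eq_bigr => i _.
by rewrite lnK// posrE ltr0n.
Qed.

Let scale_powR n (t : R) : scale M n `^ t = expR (- (t * lnM n)).
Proof.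
by rewrite scale_expR /powR (negbTE (lt0r_neq0 (expR_gt0 _))) expRK mulrN.
Qed.

Lemma small_cover_sum (s : R) (t : R) : s < t ->
  (forall n, exists2 m, (n <= m)%N & entropy_ratio m < s) ->
  forall e, 0 < e -> exists n, scale M n.+1 <= e /\
     #|address N n.+1|%:R * scale M n.+1 `^ t <= e.
Proof.
move=> st hs e e0; have ts : 0 < t - s by rewrite subr_gt0.
have m0 : 0 < Num.min e (e `^ (t - s)^-1) by rewrite lt_min e0 powR_gt0.
have [k hk] := half_expn_small m0; have [n kn sn] := hs k.
exists n.
have : scale M n.+1 <= Num.min e (e `^ (t - s)^-1).
  apply: le_trans hk; apply: le_trans (scale_le_half hM _) _.
  by rewrite lef_pV2 ?posrE ?exprn_gt0// ler_weXn2l ?ler1n// leqW.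
rewrite le_min => /andP[h1 h2]; split=> //.
apply: (@le_trans _ _ (scale M n.+1 `^ (t - s))).
  rewrite card_expR !scale_powR -expRD ler_expR.
  have : lnN n.+1 <= s * lnM n.+1.
    by rewrite -ler_pdivrMr ?lnM_gt0//; exact: ltW.
  by rewrite mulrBl; lra.
apply: (@le_trans _ _ ((e `^ (t - s)^-1) `^ (t - s))).
  apply: ge0_ler_powR => //; first exact: ltW.
  - by rewrite nnegrE ltW// scale_gt0.
  - by rewrite nnegrE powR_ge0.
by rewrite -powRrM mulVf ?lt0r_neq0// powRr1// ltW.
Qed.

(** The constant takes care of the ranks below [n], where the number of squares
    is only known to be at least 1. *)
Lemma card_address_lower (s : R) : 0 <= s ->
  (exists n, forall m, (n <= m)%N -> s <= entropy_ratio m) ->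
  exists C : R, forall k, (#|address N k|%:R)^-1 <= C * scale M k `^ s.
Proof.
move=> s0 [n hn].
have scn : 0 < scale (R := R) M n `^ s by rewrite powR_gt0// scale_gt0.
have scn1 : scale (R := R) M n `^ s <= 1.
  by rewrite scale_powR expR_le1 oppr_le0 mulr_ge0// /lnM sumr_ge0// => i _;
     rewrite ln_ge0// ler1n ltnW.
exists (scale M n `^ s)^-1 => k; have [kn|nk] := leqP k n.
  apply: (@le_trans _ _ 1).
    by rewrite card_expR -expRN expR_le1 oppr_le0 lnN_ge0.
  rewrite mulrC ler_pdivlMr// mul1r; apply: ge0_ler_powR => //.
  - by rewrite nnegrE ltW// scale_gt0.
  - by rewrite nnegrE ltW// scale_gt0.
  - apply: le_trans (scale_le hM kn) _.
    rewrite ler_pdivrMr ?exprn_gt0// ler_peMr ?(ltW (scale_gt0 hM k))//.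
    by rewrite exprn_ege1// ler1n.
apply: (@le_trans _ _ (scale M k `^ s)); last first.
  by rewrite ler_peMl ?powR_ge0// invf_ge1.
case: k nk => // k nk; rewrite card_expR -expRN scale_powR ler_expR lerN2.
by rewrite -ler_pdivlMr ?lnM_gt0//; exact: hn.
Qed.

End entropy.

Unset Implicit Arguments.

(** * Dimension of the projections *)

Theorem theorem2p1 (R : realType) (d : measure_display)
    (Omega : measurableType d) (P : probability Omega R)
    (M N : nat -> nat)
    (hM : forall n : nat, (2 <= M n)%N)
    (hN0 : forall n : nat, (0 < N n)%N)
    (hN : forall n : nat, (N n <= M n ^ 2)%N)
    (X : forall n : nat, address N n.+1 -> Omega -> 'I_(M n) * 'I_(M n))
    (hX : random_choices P X)
    (s : \bar R)
    (hs : s = limn_einf (fun n : nat =>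
       ((\sum_(i < n.+1) ln (N i)%:R) / (\sum_(i < n.+1) ln (M i)%:R))%:E))
    (hs1 : (s < 1)%E) :
  {ae P, forall omega : Omega, forall p u : R * R, u != 0 ->
    hausdorff_dim (line_proj p u @` random_cantor_set X omega) = s}.
Proof.
have {}hs : s = limn_einf (fun n => (entropy_ratio (R := R) M N n)%:E) by exact: hs.
have s_ge0 : (0 <= s)%E.
  rewrite leNgt hs; apply/negP => /limn_einf_lt_infinitely_often/(_ 0%N)[n _].
  by rewrite lte_fin ltNge entropy_ratio_ge0.
have [r sr] : exists r, s = r%:E.
  exists (fine s); rewrite fineK// ge0_fin_numE//.
  by apply: lt_trans hs1 _; rewrite ltry.
have r0 : 0 <= r by rewrite -lee_fin -sr.
have r1 : r < 1 by rewrite -lte_fin -sr.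
rewrite sr in hs *.
have upper (c : choices M N) (p u : R * R) : u != 0 ->
    (hausdorff_dim (line_proj p u @` cantor_set c) <= r%:E)%E.
  move=> u0; apply/lee_addgt0Pr => e e0; rewrite -EFinD.
  apply: hausdorff_dim_proj_le => //; first by rewrite addr_ge0// ltW.
  apply: (@small_cover_sum R M N hM hN0 (r + e / 2)); first by lra.
  move=> n; have [|m nm hm] := @limn_einf_lt_infinitely_often R
    (fun n => (entropy_ratio M N n)%:E) (r + e / 2)%:E _ n.
    by rewrite -hs lte_fin; lra.
  by exists m.
(* Countably many exponents increasing to r, to intersect countably many
   almost sure events. *)
pose t k : R := r * (1 - 2 ^- k).
have lower : {ae P, forall omega : Omega, forall k : nat, forall p u : R * R,
    u != 0 ->
    ((t k)%:E <= hausdorff_dim (line_proj p u @` random_cantor_set X omega))%E}.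
  apply: ae_foralln => k; have [rE|rn0] := eqVneq r 0.
    by apply: aeW => omega p u _; rewrite /t rE mul0r hausdorff_dim_ge0.
  have rp : 0 < r by rewrite lt0r rn0.
  have q0 : 0 < 2 ^- k :> R by rewrite invr_gt0 exprn_gt0.
  have q1 : 2 ^- k <= 1 :> R by rewrite invf_le1 ?exprn_gt0// exprn_ege1// ler1n.
  have tk0 : 0 <= t k by rewrite /t mulr_ge0// subr_ge0.
  have tkr : t k < r by rewrite /t; nra.
  pose s1 := (t k + r) / 2.
  have [C hC] : exists C : R, forall k, (#|address N k|%:R)^-1 <= C * scale M k `^ s1.
    apply: card_address_lower => //; first by rewrite /s1; lra.
    have [|n hn] := @lt_limn_einf_eventually R
      (fun n => (entropy_ratio M N n)%:E) s1%:E.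
      by rewrite -hs lte_fin /s1; lra.
    by exists n => m nm; rewrite -lee_fin; exact: hn.
  have [||level [hlevel hae]] :=
    @ae_strip_count R M N hM hN0 d Omega P X hX C s1 (t k) tk0 _ _ hC.
  - by rewrite /s1; lra.
  - by rewrite /s1; lra.
  apply: filterS hae => omega [K hK] p u u0.
  exact: (hausdorff_dim_proj_ge hM hN0 p u0 hlevel hK).
apply: filterS lower => omega hl p u u0; apply/eqP; rewrite eq_le.
rewrite upper//=; apply/lee_addgt0Pr => e e0.
have [k hk] : exists k, r * 2 ^- k <= e.
  have [k hk] := half_expn_small e0; exists k; apply: le_trans hk.
  by rewrite ler_piMl ?ltW// invr_gt0 exprn_gt0.
apply: (@le_trans _ _ ((t k)%:E + e%:E)%E); last by rewrite leeD2r// hl.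
by rewrite -EFinD lee_fin /t; lra.
Qed.
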